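(* Let $1\le r\le n$, let $V\in\mathbb{R}^{n\times r}_*$ be a solution of the problem of maximizing $\mathcal{I}(V^TY,X)$ over $V\in\mathbb{R}^{n\times r}_*$, and let $W=V^TY$. Let $(\lambda_i)_{i=1}^n$ be the eigenvalues, sorted in decreasing order, of the generalized eigenvalue problem $C_Yv=\lambda C_Ev$, $\lambda\in\mathbb{R}$, $v\in\mathbb{R}^n$, and let $(\nu_i)_{i=1}^n$ be the eigenvalues (i.e. $\lambda_i=1+\nu_i$) of the generalized eigenvalue problem $C_Av=\nu C_Ev$, $\nu\ge0$, $v\in\mathbb{R}^n$. Let $m\le q<n$ be the rank of $B\in\mathbb{R}^{n\times q}$. Then $C_A=BC_XB^T$ is a rank-$m$ matrix, and, if $\mathcal{I}(Y,X)\neq 0$, the relative error on the mutual information is given by $$\frac{\mathcal{I}(Y,X)-\mathcal{I}(W,X)}{\mathcal{I}(Y,X)}=1-\frac{\sum_{i=1}^r\log(1+\nu_i)}{\sum_{i=1}^m\log(1+\nu_i)}.$$ The condition $r\ge m$ implies $\mathcal{I}(W,X)=\mathcal{I}(Y,X)$, i.e. the mutual informations between the observations and the parameter of interest are the same for the full and the reduced model. In particular, the condition $r\ge m$ is satisfied for $r=q$.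
   Context: Linear Gaussian model: $Y=BX+E$ with $B\in\mathbb{R}^{n\times q}$ deterministic, $X\sim\mathcal{N}(m_X,C_X)$ in $\mathbb{R}^q$ and $E\sim\mathcal{N}(m_E,C_E)$ in $\mathbb{R}^n$ independent, $C_X$ and $C_E$ symmetric positive definite. $C_A=BC_XB^T$, and $C_Y=C_A+C_E$ is the covariance of $Y$. $\mathbb{R}^{n\times r}_*$ is the set of full-rank matrices in $\mathbb{R}^{n\times r}$. Eigenvalues are counted with multiplicity. The (differential) entropy of a random vector $Z$ with density $f_Z$ is $H(Z)=\mathbb{E}_Z(-\log f_Z(Z))$, and the mutual information is $\mathcal{I}(Z_0,Z_1)=H(Z_0)+H(Z_1)-H(Z_0,Z_1)$, where $H(Z_0,Z_1)$ is the entropy of the joint distribution of $(Z_0,Z_1)$. *)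

(* Defs.v *)
From HB Require Import structures.
From mathcomp Require Import all_boot all_order all_algebra.
From mathcomp Require Import all_classical all_reals all_analysis.

Set Implicit Arguments.
Unset Strict Implicit.
Unset Printing Implicit Defensive.
Import Order.TTheory GRing.Theory Num.Theory.
Import numFieldNormedType.Exports.

Local Open Scope classical_set_scope.
Local Open Scope ring_scope.

(* Column vectors carry the product sigma-algebra, generated by the
   coordinates; over [R : realType] it is the Borel sigma-algebra of R^n. *)

Definition measure_cV_display : measure_display -> measure_display.
Proof. exact. Qed.

Section measurable_cV.
Context {d} {T : sigmaRingType d}.
Variable n : nat.

Let coors : 'I_n -> 'cV[T]_n -> T := fun i x => x i 0.

Let cV_set0 : g_sigma_preimage coors set0.
Proof. exact: sigma_algebra0. Qed.

Let cV_setC A : g_sigma_preimage coors A -> g_sigma_preimage coors (~` A).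
Proof. exact: sigma_algebraC. Qed.

Let cV_bigcup (F : _^nat) : (forall i, g_sigma_preimage coors (F i)) ->
  g_sigma_preimage coors (\bigcup_i (F i)).
Proof. exact: sigma_algebra_bigcup. Qed.

HB.instance Definition _ := @isMeasurable.Build (measure_cV_display d)
  'cV[T]_n (g_sigma_preimage coors) cV_set0 cV_setC cV_bigcup.

End measurable_cV.

Lemma measurable_coord d (T : sigmaRingType d) n (i : 'I_n) :
  measurable_fun [set: 'cV[T]_n] (fun x => x i 0).
Proof.
move=> _ Y mY; rewrite setTI; apply: sub_sigma_algebra => /=.
rewrite -bigcup_seq/=; exists i => /=; first by rewrite mem_index_enum.
by exists Y => //; rewrite setTI.
Qed.

Lemma measurable_fun_cVP d1 d2 (T1 : measurableType d1)
    (T2 : measurableType d2) n (f : T1 -> 'cV[T2]_n) :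
  (forall i, measurable_fun [set: T1] (fun x => f x i 0)) <->
  measurable_fun [set: T1] f.
Proof.
split=> [mf|mf i]; last first.
  exact: (measurableT_comp (measurable_coord i) mf).
move=> _ A mA; rewrite setTI; move: A mA.
apply: smallest_sub => [|A].
  split=> /= [|A|F].
  - by rewrite preimage_set0.
  - by move=> mA; rewrite setTD preimage_setC; exact: measurableC.
  - by move=> mF; rewrite preimage_bigcup; exact: bigcupT_measurable.
by rewrite -bigcup_seq => -[i _ [B mB <-]]; rewrite setTI -[_ @^-1` _]setTI;
   exact: mf.
Qed.

(* Lebesgue measure on R^n: the n-fold product of [lebesgue_measure],
   transported to column vectors; on R^0 it is the unit mass. *)

Section lebesgue_cV.
Variable R : realType.

Definition cons_cV k (p : R * 'cV[R]_k) : 'cV[R]_k.+1 :=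
  col_mx (p.1%:M : 'cV[R]_1) p.2.

Lemma cons_cVE k (p : R * 'cV[R]_k) i :
  cons_cV p i 0 = if unlift ord0 i is Some j then p.2 j 0 else p.1.
Proof.
case: unliftP => [j|] ->.
  by rewrite -rshift1 /cons_cV (col_mxEd (p.1%:M : 'cV[R]_1) p.2).
have -> : ord0 = lshift k ord0 :> 'I_(1 + k) by exact/val_inj.
by rewrite /cons_cV (col_mxEu (p.1%:M : 'cV[R]_1) p.2) mxE.
Qed.

Lemma measurable_cons_cV k :
  measurable_fun [set: R * 'cV[R]_k] (@cons_cV k).
Proof.
apply/measurable_fun_cVP => i.
under eq_fun do rewrite cons_cVE.
case: (unlift _ _) => [j|]; last exact: measurable_fst.
exact: (measurableT_comp (measurable_coord j) measurable_snd).
Qed.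

Section lebesgue_cV_step.
Variables (k : nat) (mu : {sigma_finite_measure set 'cV[R]_k -> \bar R}).

Definition cons_measure : set 'cV[R]_k.+1 -> \bar R :=
  pushforward (lebesgue_measure \x mu)%E (@cons_cV k).

Let cons_measure0 : cons_measure set0 = 0%E.
Proof. by rewrite /cons_measure /pushforward preimage_set0 measure0. Qed.

Let cons_measure_ge0 A : (0 <= cons_measure A)%E.
Proof. by rewrite /cons_measure /pushforward measure_ge0. Qed.

Let cons_measure_sigma_additive : semi_sigma_additive cons_measure.
Proof.
move=> F mF tF mUF; rewrite /cons_measure /pushforward preimage_bigcup.
apply: measure_semi_sigma_additive.
- by move=> i; rewrite -[X in measurable X]setTI; exact: measurable_cons_cV.
- apply/trivIsetP => /= i j _ _ ij; rewrite -preimage_setI.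
  by move/trivIsetP : tF => /(_ _ _ _ _ ij) ->//; rewrite preimage_set0.
- rewrite -preimage_bigcup -[X in measurable X]setTI.
  exact: measurable_cons_cV.
Qed.

HB.instance Definition _ := isMeasure.Build _ _ _ cons_measure
  cons_measure0 cons_measure_ge0 cons_measure_sigma_additive.

Let cons_measure_sigma_finite : sigma_finite setT cons_measure.
Proof.
have /sigma_finiteP[F [FT ndF Foo]] := sigma_finiteT (@lebesgue_measure R).
have /sigma_finiteP[G [GT ndG Goo]] := sigma_finiteT mu.
pose uncons (v : 'cV[R]_k.+1) : measurableTypeR R * 'cV[R]_k :=
  (v ord0 0, \col_i v (lift ord0 i) 0).
have muncons : measurable_fun [set: 'cV[R]_k.+1] uncons.
  apply/measurable_fun_pair; first exact: measurable_coord.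
  apply/measurable_fun_cVP => i; under eq_fun do rewrite mxE.
  exact: measurable_coord.
have consK : cancel (@cons_cV k) uncons.
  move=> [x v]; rewrite /uncons cons_cVE unlift_none; congr pair.
  by apply/colP => i; rewrite mxE cons_cVE liftK.
exists (fun i => uncons @^-1` (F i `*` G i)).
  apply/esym; rewrite -subTset => v _.
  have [i _ Fi] : (\bigcup_i F i) (uncons v).1 by rewrite -FT.
  have [j _ Gj] : (\bigcup_i G i) (uncons v).2 by rewrite -GT.
  exists (maxn i j) => //; split.
  - by move: Fi; exact/subsetPset/ndF/leq_maxl.
  - by move: Gj; exact/subsetPset/ndG/leq_maxr.
move=> i; have [mFi Fi] := Foo i; have [mGi Gi] := Goo i; split.
  by rewrite -[X in measurable X]setTI; apply: muncons => //; exact: measurableX.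
rewrite /cons_measure /pushforward -comp_preimage.
rewrite (_ : uncons \o @cons_cV k = id) ?preimage_id; last exact/funext.
by rewrite product_measure1E// lte_mul_pinfty// ge0_fin_numE.
Qed.

HB.instance Definition _ := Measure_isSigmaFinite.Build _ _ _ cons_measure
  cons_measure_sigma_finite.

End lebesgue_cV_step.

Fixpoint lebesgue_cV k : {sigma_finite_measure set 'cV[R]_k -> \bar R} :=
  if k is k'.+1 then cons_measure (lebesgue_cV k')
  else \d_(0 : 'cV[R]_0).

Lemma lebesgue_cV_box k (A : 'I_k -> set R) :
  (forall i, measurable (A i)) ->
  lebesgue_cV k [set v | forall i, A i (v i 0)] =
  (\prod_(i < k) lebesgue_measure (A i))%E.
Proof.
elim: k A => [|k IHk] A mA.
  by rewrite big_ord0 /= diracE mem_set// => -[].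
rewrite big_ord_recl -IHk => [|i]; last exact: mA.
rewrite /= /cons_measure /pushforward.
rewrite -product_measure1E; last 2 first.
- exact: mA.
- rewrite (_ : (fun v => _) = \bigcap_(i in [set: 'I_k])
      (fun v : 'cV[R]_k => v i 0) @^-1` A (lift ord0 i)).
    apply: fin_bigcap_measurable => // i _.
    by rewrite -[X in measurable X]setTI; apply: measurable_coord.
  by apply/seteqP; split=> [v Av i _|v Av i]; exact: Av.
congr product_measure1; apply/seteqP; split=> -[x v] /= => [Av|[Ax Av] i].
  split=> [|i]; first by have := Av ord0; rewrite cons_cVE unlift_none.
  by have := Av (lift ord0 i); rewrite cons_cVE liftK.
by rewrite cons_cVE; case: unliftP => [j|] ->.
Qed.

End lebesgue_cV.
Arguments lebesgue_cV {R} k.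

Section random_vectors.
Context {R : realType} {d : measure_display} {T : measurableType d}.
Variable P : probability T R.

Definition has_pdf k (Z : T -> 'cV[R]_k) (f : 'cV[R]_k -> R) : Prop :=
  [/\ measurable_fun setT f, (forall z, 0 <= f z) &
      forall A, measurable A ->
        P (Z @^-1` A) = (\int[lebesgue_cV k]_(z in A) (f z)%:E)%E].

(* A density is unique up to a null set for the Lebesgue measure, hence also
   for the law of Z, so that the entropy does not depend on the choice made by
   [xget]; the default value 0 is used only if Z has no density. *)
Definition pdf k (Z : T -> 'cV[R]_k) : 'cV[R]_k -> R :=
  xget (fun=> 0) [set f | has_pdf Z f].

(* The value [ln 0 = 0] is harmless: the density of Z vanishes at Z with
   probability 0. *)
Definition entropy k (Z : T -> 'cV[R]_k) : \bar R :=
  'E_P[fun t => - ln (pdf Z (Z t))].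

Definition mutual_info k l (Z0 : T -> 'cV[R]_k) (Z1 : T -> 'cV[R]_l) : \bar R :=
  (entropy Z0 + entropy Z1 - entropy (fun t => col_mx (Z0 t) (Z1 t)))%E.

Definition independent_vectors k l (Z0 : T -> 'cV[R]_k) (Z1 : T -> 'cV[R]_l) :=
  forall A B, measurable A -> measurable B ->
    P (Z0 @^-1` A `&` Z1 @^-1` B) = (P (Z0 @^-1` A) * P (Z1 @^-1` B))%E.

Definition gaussian_pdf k (m : 'cV[R]_k) (C : 'M[R]_k) (z : 'cV[R]_k) : R :=
  (Num.sqrt ((2 * pi) ^+ k * \det C))^-1 *
  expR (- ((z - m)^T *m invmx C *m (z - m)) 0 0 / 2).

(* Nondegenerate normal distribution N(m, C); meant for C symmetric positive
   definite. *)
Definition gaussian k (Z : T -> 'cV[R]_k) (m : 'cV[R]_k) (C : 'M[R]_k) : Prop :=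
  has_pdf Z (gaussian_pdf m C).

End random_vectors.

Section matrices.
Variable R : realType.

Definition sym_posdef k (C : 'M[R]_k) : Prop :=
  C^T = C /\ forall v : 'cV[R]_k, v != 0 -> 0 < (v^T *m C *m v) 0 0.

Definition full_rank n r (V : 'M[R]_(n, r)) : Prop := \rank V = minn n r.

(* The row space of [gen_eigenspace A M a] consists of the transposes of the
   solutions v of A v = a M v. *)
Definition gen_eigenspace n (A M : 'M[R]_n) (a : R) : 'M[R]_n :=
  kermx (A - a *: M)^T.

Lemma gen_eigenspaceP n (A M : 'M[R]_n) (a : R) (v : 'cV[R]_n) :
  reflect (A *m v = a *: (M *m v)) (v^T <= gen_eigenspace A M a)%MS.
Proof.
apply: (iffP sub_kermxP); rewrite -trmx_mul mulmxBl -scalemxAl.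
  by move/(congr1 trmx); rewrite trmxK trmx0; exact: subr0_eq.
by move=> ->; rewrite subrr trmx0.
Qed.

(* l lists in decreasing order the eigenvalues of A v = a M v: each real a
   occurs as often as the dimension of its eigenspace (so not at all if a is
   not an eigenvalue). *)
Definition gen_eigenvalues n (A M : 'M[R]_n) (l : 'I_n -> R) : Prop :=
  (forall i j : 'I_n, (i <= j)%N -> l j <= l i) /\
  forall a : R, #|[set i | l i == a]%SET| = \rank (gen_eigenspace A M a).

End matrices.

(* Main.v *)
Require Import Defs.
From HB Require Import structures.
From mathcomp Require Import all_boot all_order all_algebra.
From mathcomp Require Import all_classical all_reals all_analysis.
From mathcomp Require Import measurable_realfun ring lra.

(* With N = V^T E, the vector (W, X) is the image of (N, X) under a unipotent
   linear map, so H(W, X) = H(N) + H(X) and I(W, X) = H(W) - H(N) =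
   (ln det (V^T C_Y V) - ln det (V^T C_E V)) / 2. The ratio of the two
   determinants is at most the product of the r largest generalized eigenvalues, with equality
   for the corresponding eigenvectors: the row space of V^T contains a vector
   with Rayleigh quotient at most lambda_r, which is split off by passing to its
   C_E-orthogonal complement and by Fischer's inequality. Hence
   I(W, X) = (sum_(i < r) ln (1 + nu_i)) / 2, and nu_i = 0 beyond the rank m
   of C_A. A spectral theorem is not needed: the multiplicities in the
   list of eigenvalues add up to n. *)

Set Implicit Arguments.
Unset Strict Implicit.
Unset Printing Implicit Defensive.
Import Order.TTheory GRing.Theory Num.Theory.
Import numFieldNormedType.Exports.

Local Open Scope classical_set_scope.
Local Open Scope ring_scope.

(** * Positive definite matrices *)

Section posdef.
Variable R : realType.

(** [pdf] is an arbitrary choice among the densities, so W, X and (W, X) must each be shown to have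
    an explicit Gaussian density before any determinant appears. The delicate case is the law of
    [L *m Z] for a rectangular [L], where a Jacobian makes no sense; translation invariance of
    Lebesgue measure, together with an auxiliary Gaussian weight of mass 1, replaces it. As
    [lebesgue_cV] is built one coordinate at a time, the Gaussian normalizing constant follows by
    induction, with Schur complements giving the same recursion for the quadratic form and for the
    determinant. On the algebraic side, the eigenvector basis [U] is not normalized: its Gram matrix
    with respect to C_E need not be diagonal inside a repeated eigenvalue. Only the fact that this
    Gram matrix commutes with the diagonal matrix of eigenvalues is used. The determinant bound
    holds for every V of full rank; the optimality of the given V enters once, in the comparison
    with the eigenvector matrix. *)

Lemma sym_posdef_congr k p (C : 'M[R]_k) (L : 'M[R]_(p, k)) :
  sym_posdef C -> row_free L -> sym_posdef (L *m C *m L^T).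
Proof.
move=> [Csym Cpos] Lfree; split; first by rewrite !trmx_mul trmxK Csym mulmxA.
move=> v v0; have := Cpos (L^T *m v); rewrite trmx_mul trmxK !mulmxA; apply.
apply: contra_neq v0 => /(congr1 trmx); rewrite trmx_mul trmxK trmx0 => vL.
apply: trmx_inj; rewrite trmx0; apply/eqP.
by rewrite -(mulmx_free_eq0 _ Lfree) vL.
Qed.

Lemma sym_posdef_ge0 k (C : 'M[R]_k) (v : 'cV[R]_k) :
  sym_posdef C -> 0 <= (v^T *m C *m v) 0 0.
Proof.
move=> [_ Cpos]; have [->|v0] := eqVneq v 0; last exact/ltW/Cpos.
by rewrite mulmx0 mxE.
Qed.

Lemma sym_posdef_unitmx k (C : 'M[R]_k) : sym_posdef C -> C \in unitmx.
Proof.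
move=> [Csym Cpos]; rewrite -row_free_unit; apply/row_freeP.
have : \rank (kermx C) = 0%N.
  apply/eqP; rewrite mxrank_eq0; apply/eqP/row_matrixP => i.
  rewrite row0; apply/eqP; apply: contraT => ri.
  have := Cpos (row i (kermx C))^T; rewrite trmxK trmx_eq0 ri => /(_ isT).
  by rewrite -row_mul mulmx_ker row0 mul0mx mxE ltxx.
rewrite mxrank_ker => /eqP; rewrite subn_eq0 => h.
by apply/row_freeP; rewrite /row_free eqn_leq rank_leq_row.
Qed.

Lemma sym_posdef_invmx k (C : 'M[R]_k) : sym_posdef C -> sym_posdef (invmx C).
Proof.
move=> CP; have Cu := sym_posdef_unitmx CP; have [Csym _] := CP.
have -> : invmx C = invmx C *m C *m (invmx C)^T.
  by rewrite mulVmx// mul1mx trmx_inv Csym.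
by apply: sym_posdef_congr => //; rewrite row_free_unit unitmx_inv.
Qed.

Lemma sym_posdefD k (C D : 'M[R]_k) : sym_posdef C ->
  D^T = D -> (forall v : 'cV[R]_k, 0 <= (v^T *m D *m v) 0 0) ->
  sym_posdef (D + C).
Proof.
move=> [Csym Cpos] Dsym Dpos; split; first by rewrite linearD/= Csym Dsym.
by move=> v v0; rewrite mulmxDr mulmxDl mxE ltr_wpDl// Cpos.
Qed.

Section schur.
Variables (k : nat) (C : 'M[R]_(1 + k)).
Hypothesis CP : sym_posdef C.

Definition schur_pivot := C 0 0.
Definition schur_col : 'cV[R]_k := dlsubmx C.
Definition schur_compl : 'M[R]_k :=
  drsubmx C - schur_pivot^-1 *: (schur_col *m schur_col^T).

Lemma schur_block :
  C = block_mx schur_pivot%:M schur_col^T schur_col (drsubmx C).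
Proof.
have [Csym _] := CP.
rewrite -[LHS]submxK; congr block_mx.
  apply/matrixP => i j; rewrite !ord1 !mxE eqxx mulr1n.
  by congr (C _ _); apply/val_inj.
by rewrite /schur_col trmx_dlsub Csym.
Qed.

Lemma schur_pivot_gt0 : 0 < schur_pivot.
Proof.
have [_ Cpos] := CP.
have := Cpos (delta_mx 0 0); rewrite trmx_delta -rowE -colE !mxE; apply.
by apply/eqP => /matrixP/(_ 0 0)/eqP; rewrite !mxE !eqxx/= oner_eq0.
Qed.

(** Completing the square in the first coordinate. This yields both the positivity of the complement
    and, later, the inner one-dimensional Gaussian integral. *)
Lemma schur_quad (t : 'cV[R]_1) (v : 'cV[R]_k) :
  ((col_mx t v)^T *m C *m col_mx t v) 0 0 =
  schur_pivot * (t 0 0 + schur_pivot^-1 * (schur_col^T *m v) 0 0) ^+ 2 +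
  (v^T *m schur_compl *m v) 0 0.
Proof.
have a0 := lt0r_neq0 schur_pivot_gt0.
rewrite {1}schur_block tr_col_mx mul_row_block mul_row_col.
rewrite /schur_compl mulmxBr mulmxBl -scalemxAr -scalemxAl.
rewrite !mulmxA -(mulmxA _ schur_col^T v) !mulmxDl.
have [s sE] : exists s : R, schur_col^T *m v = s%:M.
  by exists ((schur_col^T *m v) 0 0); rewrite -mx11_scalar.
have sE' : v^T *m schur_col = s%:M.
  by rewrite -[LHS]trmxK trmx_mul trmxK sE tr_scalar_mx.
rewrite sE' -(mulmxA _ schur_col^T v) sE.
have [u uE] : exists u : R, t = u%:M by exists (t 0 0); rewrite -mx11_scalar.
rewrite uE tr_scalar_mx -!scalar_mxM !mxE eqxx !mulr1n.
by set w := \sum__ _; field.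
Qed.

Lemma schur_sym_posdef : sym_posdef schur_compl.
Proof.
have [Csym Cpos] := CP; split.
  rewrite /schur_compl linearB/= linearZ/= trmx_mul trmxK.
  by rewrite -{2}Csym trmx_drsub.
move=> v v0.
(* The first coordinate is chosen so that the completed square vanishes. *)
have := Cpos (col_mx (- (schur_pivot^-1 * (schur_col^T *m v) 0 0))%:M v).
rewrite schur_quad [(_%:M) 0 0]mxE eqxx mulr1n addNr expr0n/= mulr0 add0r; apply.
apply: contra_neq v0 => /(congr1 (@dsubmx _ 1 k 1)).
by rewrite col_mxKd linear0.
Qed.

Lemma schur_det : \det C = schur_pivot * \det schur_compl.
Proof.
have a0 := lt0r_neq0 schur_pivot_gt0.
have -> : C = block_mx 1%:M 0 (schur_pivot^-1 *: schur_col) 1%:M *m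
    block_mx schur_pivot%:M schur_col^T 0 schur_compl.
  rewrite {1}schur_block mulmx_block !mul1mx !mul0mx !addr0.
  rewrite mul_mx_scalar scalerA divff// scale1r -scalemxAl /schur_compl.
  by rewrite addrCA subrr addr0.
by rewrite det_mulmx det_lblock det_ublock !det1 !mul1r det_scalar1.
Qed.

End schur.

Lemma sym_posdef_det_gt0 k (C : 'M[R]_k) : sym_posdef C -> 0 < \det C.
Proof.
elim: k C => [|k IH] C CP; first by rewrite det_mx00.
rewrite (@schur_det k)// mulr_gt0 ?schur_pivot_gt0//.
exact/IH/schur_sym_posdef.
Qed.

End posdef.

(** * Generalized eigenvalues and maximal determinants *)

Lemma row_free_exists (F : fieldType) m n r (A : 'M[F]_(m, n)) :
  (r <= \rank A)%N ->
  exists N : 'M[F]_(r, n), row_free N /\ (N <= A)%MS.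
Proof.
move=> rA; pose f : 'I_r -> 'I_(\rank A) := widen_ord rA.
exists (rowsub f (row_base A)); split; last first.
  apply/row_subP => i; rewrite row_rowsub.
  by rewrite (submx_trans (row_sub _ _))// eq_row_base.
have /row_freeP[M AM] := row_base_free A.
apply/row_freeP; exists (M *m \matrix_(i, j) (i == f j)%:R).
rewrite mulmxA mul_rowsub_mx AM mul_rowsub_mx mul1mx.
by apply/matrixP => i j; rewrite !mxE; congr (_%:R); rewrite -val_eqE.
Qed.

Section generalized_eigenvectors.
Variables (R : realType) (n : nat) (A M : 'M[R]_n) (l : 'I_n -> R).
Hypotheses (Asym : A^T = A) (MP : sym_posdef M) (Al : gen_eigenvalues A M l).

Let diag_l : 'M[R]_n := diag_mx (\row_i l i).

(** Passing to ordinary eigenspaces of [A *m invmx M] gives access to the fact that eigenspaces for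
    distinct eigenvalues are in direct sum. *)
Lemma gen_eigenspace_eigenspace a :
  (gen_eigenspace A M a :=: eigenspace (A *m invmx M) a)%MS.
Proof.
have [Msym _] := MP; have Mu := sym_posdef_unitmx MP.
apply/eqmxP/andP; split; apply/rV_subP => v.
  move/sub_kermxP; rewrite linearB/= linearZ/= Asym Msym mulmxBr -scalemxAr.
  move/subr0_eq => vA; apply/eigenspaceP.
  by rewrite mulmxA vA -scalemxAl -mulmxA mulmxV// mulmx1.
move/eigenspaceP => vA; apply/sub_kermxP.
rewrite linearB/= linearZ/= Asym Msym mulmxBr -scalemxAr; apply/eqP.
by rewrite subr_eq0 scalemxAl -vA -!mulmxA mulVmx// mulmx1.
Qed.

(** The indices i with [l i = a] are as many as the dimension of the eigenspace of a, so they can be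
    matched with the rows of a basis of it. The rows thus obtained span every eigenspace, and the
    dimensions add up to n. *)
Lemma gen_eigenbasis :
  exists U : 'M[R]_n, U \in unitmx /\ U *m A = diag_l *m U *m M.
Proof.
have [_ Acount] := Al; have [Msym _] := MP.
pose cls (a : R) : {set 'I_n} := [set i | l i == a]%SET.
(* The default 0 is never reached: the position of i within its class [cls (l i)] is below the size
   of the class, which is the rank of the eigenspace. *)
pose sel (a : R) (k : nat) : 'rV[R]_n :=
  if insub k is Some j then row j (row_base (gen_eigenspace A M a)) else 0.
pose U : 'M[R]_n := \matrix_(i < n) sel (l i) (index i (enum (cls (l i)))).
have selS a k : (sel a k <= gen_eigenspace A M a)%MS.
  rewrite /sel; case: insub => [j|]; last exact: sub0mx.
  by rewrite (submx_trans (row_sub _ _))// eq_row_base.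
have UA : U *m A = diag_l *m U *m M.
  apply/row_matrixP => i; rewrite !row_mul row_diag_mx mxE -scalemxAl -rowE.
  rewrite rowK; have /sub_kermxP := selS (l i) (index i (enum (cls (l i)))).
  rewrite linearB/= linearZ/= Asym Msym mulmxBr -scalemxAr.
  by move/subr0_eq ->; rewrite scalemxAl.
have EU a : (gen_eigenspace A M a <= U)%MS.
  rewrite -eq_row_base; apply/row_subP => j.
  have jlt : (j < size (enum (cls a)))%N by rewrite -cardE Acount.
  have [i0 _] : exists i0 : 'I_n, i0 \in enum (cls a).
    by case: (enum _) jlt => // i0 s _; exists i0; rewrite mem_head.
  pose i := nth i0 (enum (cls a)) j.
  have ia : l i = a.
    by have := mem_nth i0 jlt; rewrite mem_enum inE => /eqP.
  suff -> : row j (row_base (gen_eigenspace A M a)) = row i U by exact: row_sub.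
  rewrite rowK ia /sel index_uniq ?enum_uniq//.
  by rewrite insubT// => jr; congr row; exact/val_inj.
exists U; split => //; rewrite -row_free_unit /row_free.
rewrite eqn_leq rank_leq_row/=.
pose rs := undup (codom l).
(* Partitioning the n indices by the value of [l] turns the sum of the dimensions into n. *)
have nE : n = \rank (\sum_(a : seq_sub rs) eigenspace (A *m invmx M) (val a))%MS.
  have /mxdirectP -> : mxdirect (\sum_(a : seq_sub rs)
      eigenspace (A *m invmx M) (val a))%MS.
    by apply: mxdirect_sum_eigenspace => a b _ _; exact: val_inj.
  rewrite /=; under eq_bigr do rewrite -gen_eigenspace_eigenspace -Acount.
  rewrite -[LHS]card_ord -sum1_card.
  have lrs i : l i \in rs by rewrite mem_undup codom_f.
  rewrite (partition_big (fun i => SeqSub (lrs i)) xpredT)//=.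
  apply: eq_bigr => a _; rewrite -sum1_card; apply: eq_bigl => i.
  by rewrite inE -val_eqE.
rewrite [X in (X <= _)%N]nE; apply: mxrankS; apply/sumsmx_subP => a _.
by rewrite -gen_eigenspace_eigenspace.
Qed.

End generalized_eigenvectors.

(** Both families are sorted and take each value equally often, so they are the same list. This is
    what identifies [lambda] with [1 + nu]. *)
Lemma gen_eigenvalues_unique (R : realType) n (A M : 'M[R]_n)
    (l l' : 'I_n -> R) :
  gen_eigenvalues A M l -> gen_eigenvalues A M l' -> l =1 l'.
Proof.
move=> [ls lA] [ls' lA'].
have srt (k : 'I_n -> R) : (forall i j : 'I_n, (i <= j)%N -> k j <= k i) ->
    sorted >=%O [seq k i | i <- enum 'I_n].
  move=> kd; rewrite sorted_map; have := iota_sorted 0 n.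
  by rewrite -val_enum_ord sorted_map; apply: sub_sorted => i j; exact: kd.
suff h : [seq l i | i <- enum 'I_n] = [seq l' i | i <- enum 'I_n].
  by move=> i; move/eq_in_map : h; apply; rewrite mem_enum.
apply: (@sorted_eq _ >=%O).
- by move=> a b c ba cb; exact: le_trans cb ba.
- by move=> a b /andP[/= ba ab]; apply/eqP; rewrite eq_le ab ba.
- exact: srt.
- exact: srt.
apply/allP => a _; apply/eqP; rewrite !count_map.
have := lA' a; rewrite -lA !cardE /enum_mem !size_filter => h.
rewrite (@eq_count _ _ (mem [set i | l i == a]%SET)) -?h => [|i]; last first.
  by rewrite /= inE.
by apply: eq_count => i; rewrite /= inE.
Qed.

Lemma gen_eigenvaluesD1 (R : realType) n (A M : 'M[R]_n) (l : 'I_n -> R) :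
  gen_eigenvalues A M l -> gen_eigenvalues (A + M) M (fun i => 1 + l i).
Proof.
move=> [ls lA]; split=> [i j ij|a]; first by rewrite lerD2l ls.
rewrite (_ : gen_eigenspace (A + M) M a = gen_eigenspace A M (a - 1)).
  by rewrite -lA; apply: eq_card => i; rewrite !inE [RHS]eq_sym subr_eq eq_sym addrC.
by rewrite /gen_eigenspace scalerBl scale1r opprB addrA addrAC.
Qed.

Lemma gen_eigenvalues_ge0 (R : realType) n (A M : 'M[R]_n) (l : 'I_n -> R) i :
  sym_posdef M -> (forall v : 'cV[R]_n, 0 <= (v^T *m A *m v) 0 0) ->
  gen_eigenvalues A M l -> 0 <= l i.
Proof.
move=> [_ Mpos] Apos [_ lA].
have : (0 < \rank (gen_eigenspace A M (l i)))%N.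
  by rewrite -lA card_gt0; apply/set0Pn; exists i; rewrite inE.
rewrite lt0n mxrank_eq0 -nz_row_eq0; set v := nz_row _ => v0.
have /gen_eigenspaceP vA : (v^T^T <= gen_eigenspace A M (l i))%MS.
  by rewrite trmxK nz_row_sub.
have := Apos v^T; rewrite -mulmxA vA -scalemxAr mulmxA mxE.
by rewrite pmulr_lge0// Mpos// trmx_eq0.
Qed.

(** The value 0 occurs n - rank A times, so only rank A indices carry a nonzero value. If [l i] were
    nonzero, the i + 1 indices up to i would all carry positive values, which is too many; indices
    start at 0. *)
Lemma gen_eigenvalues_eq0 (R : realType) n (A M : 'M[R]_n) (l : 'I_n -> R)
    (i : 'I_n) :
  (forall j, 0 <= l j) -> gen_eigenvalues A M l -> (\rank A <= i)%N -> l i = 0.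
Proof.
move=> l0 [ls lA] Ai; apply/eqP; apply: contraT => li.
have card0 : #|[set j | l j == 0]%SET| = (n - \rank A)%N.
  by rewrite lA /gen_eigenspace scale0r subr0 mxrank_ker mxrank_tr.
have : ([set j : 'I_n | (j <= i)%N] \subset ~: [set j | l j == 0])%SET.
  apply/fintype.subsetP => j; rewrite !inE => ji; rewrite gt_eqF//.
  by apply: lt_le_trans (ls _ _ ji); rewrite lt0r li l0.
move/subset_leq_card; rewrite [X in (_ <= X)%N]cardsCs finset.setCK card_ord.
rewrite card0 subKn ?rank_leq_row//.
suff -> : #|[set j : 'I_n | (j <= i)%N]%SET| = i.+1 by rewrite ltnNge Ai.
rewrite -sum1_card (eq_bigl (fun j : 'I_n => (j < i.+1)%N)) => [|j].
  by rewrite (big_ord_narrow (ltn_ord i)) sum1_card card_ord.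
by rewrite inE.
Qed.

(** The left kernels compare: if v annihilates [B *m C *m B^T], then the form C vanishes at
    [v *m B], which is therefore 0. *)
Lemma mxrank_congr_posdef (R : realType) n q (B : 'M[R]_(n, q)) (C : 'M[R]_q) :
  sym_posdef C -> \rank (B *m C *m B^T) = \rank B.
Proof.
move=> [_ Cpos]; apply/eqP; rewrite eqn_leq.
rewrite -[X in (_ <= X)%N && _](mxrank_tr B) mxrankM_maxr/=.
rewrite -(@leq_sub2lE n) ?rank_leq_row// -!mxrank_ker.
apply/mxrankS/rV_subP => v /sub_kermxP vB; apply/sub_kermxP; apply/eqP.
apply: contraT => vB0; have := Cpos (v *m B)^T; rewrite trmx_eq0 trmxK => /(_ vB0).
rewrite (_ : _ *m _ = v *m (B *m C *m B^T) *m v^T); last first.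
  by rewrite trmx_mul !mulmxA.
by rewrite vB mul0mx mxE ltxx.
Qed.

(** Eliminating b by means of D shows that the determinant is [(a - s) * \det D], where s is the
    value at b of the positive definite form [invmx D]. *)
Lemma fischer_det (R : realType) k (a : R) (b : 'cV[R]_k) (D : 'M[R]_k) :
  sym_posdef D -> \det (block_mx a%:M b^T b D) <= a * \det D.
Proof.
move=> DP; have Du := sym_posdef_unitmx DP.
pose s := (b^T *m invmx D *m b) 0 0.
have -> : block_mx a%:M b^T b D =
    block_mx 1%:M (b^T *m invmx D) 0 1%:M *m block_mx (a - s)%:M 0 b D.
  rewrite mulmx_block !mul1mx !mul0mx !add0r mulmxKV//.
  by rewrite raddfB/= -mx11_scalar subrK.
rewrite det_mulmx det_ublock det_lblock !det1 !mul1r det_scalar1.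
apply: ler_wpM2r; first exact/ltW/sym_posdef_det_gt0.
rewrite lerBlDr lerDl; exact/sym_posdef_ge0/sym_posdef_invmx.
Qed.

Section generalized_rayleigh.
Variables (R : realType) (n : nat) (A M : 'M[R]_n) (l : 'I_n -> R).
Hypotheses (AP : sym_posdef A) (MP : sym_posdef M).
Hypothesis Al : gen_eigenvalues A M l.

Let Asym : A^T = A. Proof. by have [] := AP. Qed.

Lemma gen_eigen_det : \det A = \prod_i l i * \det M.
Proof.
have [U [Uu UA]] := gen_eigenbasis Asym MP Al.
have /lregP h : GRing.lreg (\det U) by apply/lregP; rewrite -unitfE -unitmxE.
have := congr1 determinant UA; rewrite !det_mulmx det_diag.
rewrite (mulrC _ (\det U)) -mulrA => /(mulfI h) ->.
by congr (_ * _); apply: eq_bigr => i _; rewrite mxE.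
Qed.

(** The first r rows of the eigenvector basis serve: for them [V *m A *m V^T] is a diagonal matrix
    of eigenvalues times [V *m M *m V^T]. *)
Lemma gen_eigen_topP r : (r <= n)%N -> exists V : 'M[R]_(r, n),
  row_free V /\
  \det (V *m A *m V^T) = \prod_(i < n | (i < r)%N) l i * \det (V *m M *m V^T).
Proof.
move=> rn; have [U [Uu UA]] := gen_eigenbasis Asym MP Al.
exists (rowsub (widen_ord rn) U); split.
  have /row_freeP[U' UU'] : row_free U by rewrite row_free_unit.
  apply/row_freeP; exists (U' *m \matrix_(i, j) (i == widen_ord rn j)%:R).
  rewrite mulmxA mul_rowsub_mx UU' mul_rowsub_mx mul1mx.
  by apply/matrixP => i j; rewrite !mxE; congr (_%:R); rewrite -val_eqE.
rewrite !mul_rowsub_mx UA -!(mulmxA (diag_mx _)).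
have -> (X : 'M[R]_(n, r)) : rowsub (widen_ord rn) (diag_mx (\row_i l i) *m X) =
    diag_mx (\row_i l (widen_ord rn i)) *m rowsub (widen_ord rn) X.
  by apply/matrixP => i j; rewrite !mul_diag_mx !mxE.
rewrite det_mulmx det_diag big_ord_narrow; congr (_ * _).
by apply: eq_bigr => i _; rewrite mxE.
Qed.

(** The dimension count of Courant and Fischer: the row space of V, of dimension r + 1, meets the
    span of the eigenvectors of index at least r, of dimension n - r. On that span all eigenvalues
    involved are at most [l r]. *)
Lemma gen_rayleigh_le (r : 'I_n) (V : 'M[R]_(r.+1, n)) : row_free V ->
  exists w : 'rV[R]_r.+1, w != 0 /\
    (w *m (V *m A *m V^T) *m w^T) 0 0 <= l r * (w *m (V *m M *m V^T) *m w^T) 0 0.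
Proof.
move=> Vfree; have [U [Uu UA]] := gen_eigenbasis Asym MP Al.
have [Msym _] := MP.
pose G := U *m M *m U^T.
have GP : sym_posdef G by apply: sym_posdef_congr; rewrite ?row_free_unit.
have [Gsym _] := GP.
pose L : 'M[R]_n := diag_mx (\row_i l i).
have UAU : U *m A *m U^T = L *m G by rewrite UA !mulmxA.
have LG : L *m G = G *m L.
  rewrite -[RHS]trmxK trmx_mul Gsym tr_diag_mx -UAU.
  by rewrite !trmx_mul trmxK Asym mulmxA.
(* Commutation with [L] makes the Gram matrix [G] block diagonal along equal eigenvalues; this is
   the available substitute for an orthonormal eigenbasis. *)
have Gl i j : G i j != 0 -> l i = l j.
  have comm (B : 'M[R]_n) : L *m B = B *m L -> B i j != 0 -> l i = l j.
    move=> + Bij => /matrixP/(_ i j).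
    by rewrite mul_diag_mx mul_mx_diag !mxE [RHS]mulrC; exact: mulIf.
  exact: comm.
(* [copid_mx r] kills the first r coordinates, so its product with [U] spans the last n - r
   eigenvectors. The two dimensions sum to n + 1. *)
have [v [v0 vV vU]] : exists v : 'rV[R]_n,
    [/\ v != 0, (v <= V)%MS & (v <= copid_mx r *m U)%MS].
  exists (nz_row (V :&: copid_mx r *m U)%MS).
  split; last 2 first.
  - by rewrite (submx_trans (nz_row_sub _))// capmxSl.
  - by rewrite (submx_trans (nz_row_sub _))// capmxSr.
  rewrite nz_row_eq0 -mxrank_eq0 -lt0n.
  have := mxrank_sum_cap V (copid_mx r *m U).
  rewrite mxrankMfree ?row_free_unit// rank_copid_mx ?(ltnW (ltn_ord r))//.
  rewrite (eqP Vfree) addSn subnKC ?(ltnW (ltn_ord r))// => h.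
  rewrite -(ltn_add2l (\rank (V + copid_mx r *m U)%MS)) h addn0 ltnS.
  exact: rank_leq_col.
have /submxP[w vw] := vV; have /submxP[c vc] := vU.
exists w; split; first by apply: contra_neq v0 => w0; rewrite vw w0 mul0mx.
pose c' := c *m copid_mx r.
have c'0 (i : 'I_n) : (i < r)%N -> c' 0 i = 0.
  move=> ir; rewrite /c' mxE big1// => j _; rewrite !mxE.
  rewrite -val_eqE; have [->|_] := eqVneq (j : nat) i.
    by rewrite ir subrr mulr0.
  by rewrite subrr mulr0.
have wVE (B : 'M[R]_n) : w *m (V *m B *m V^T) *m w^T =
    c' *m (U *m B *m U^T) *m c'^T.
  have -> : w *m (V *m B *m V^T) *m w^T = v *m B *m v^T.
    by rewrite vw trmx_mul !mulmxA.
  have -> : v = c' *m U by rewrite vc mulmxA.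
  by rewrite trmx_mul !mulmxA.
rewrite !wVE UAU -/G -subr_ge0; clear wVE vc; clearbody c' G.
(* The difference of the two sides is the form [G] at [c'] with weights [l r - l i]. These weights
   are split into square roots, one on each side of [G], which is legitimate because [sq i = sq j]
   wherever [G i j] is nonzero. Indices below r, where the weight may be negative, contribute
   nothing since [c'] vanishes there. *)
pose sq (i : 'I_n) : R := Num.sqrt (l r - l i).
pose d : 'rV[R]_n := \row_i (c' 0 i * sq i).
suff : (d *m G *m d^T) 0 0 =
    l r * (c' *m G *m c'^T) 0 0 - (c' *m (L *m G) *m c'^T) 0 0.
  by move=> <-; rewrite -{1}(trmxK d) sym_posdef_ge0.
have dE : d^T = diag_mx (\row_i sq i) *m c'^T.
  by apply/colP => i; rewrite mul_diag_mx !mxE mulrC.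
have sE : d *m G *m diag_mx (\row_i sq i) = l r *: (c' *m G) - c' *m (L *m G).
  rewrite mulmxA /L !mul_mx_diag; apply/rowP => j; rewrite !mxE.
  rewrite mulr_suml mulr_sumr -sumrB; apply: eq_bigr => i _; rewrite !mxE.
  have [ir|ir] := ltnP i r; first by rewrite c'0// !mul0r mulr0 subrr.
  have [->|Gij] := eqVneq (G i j) 0; first by rewrite !mulr0 mul0r subrr.
  have lir : 0 <= l r - l i by rewrite subr_ge0; have [+ _] := Al; apply.
  have -> : sq j = sq i by rewrite /sq (Gl _ _ Gij).
  have sq2 : sq i * sq i = l r - l i by rewrite -expr2 sqr_sqrtr.
  rewrite (mulrAC _ (sq i)) -[LHS]mulrA sq2 mulrBr [_ * l r]mulrC.
  by congr (_ - _); exact: mulrAC.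
rewrite dE mulmxA sE mulmxBl -scalemxAl.
by rewrite [LHS]mxE; congr (_ + _); rewrite mxE.
Qed.

Lemma gen_eigen_det_le r (V : 'M[R]_(r, n)) :
  (forall i, 0 <= l i) -> row_free V -> (r <= n)%N ->
  \det (V *m A *m V^T) <=
  \prod_(i < n | (i < r)%N) l i * \det (V *m M *m V^T).
Proof.
move=> l0; elim: r V => [|r IH] V Vfree rn.
  by rewrite !det_mx00 big1 ?mulr1.
pose A' := V *m A *m V^T; pose M' := V *m M *m V^T.
have AP' : sym_posdef A' by exact: sym_posdef_congr.
have MP' : sym_posdef M' by exact: sym_posdef_congr.
have [w [w0 wle]] := @gen_rayleigh_le (Ordinal rn) V Vfree.
have [_ Mpos] := MP'; have [Asym' _] := AP'; have [Msym' _] := MP'.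
have wM : 0 < (w *m M' *m w^T) 0 0.
  by have := Mpos w^T; rewrite trmx_eq0 trmxK; apply.
(* [N] spans the orthogonal complement of [w] for the form [M']. In the basis [Q] made of [w] and
   [N], the form [M'] is block diagonal, whereas [A'] keeps its cross terms and needs Fischer's
   inequality. *)
have [N [Nfree NK]] : exists N : 'M[R]_(r, r.+1),
    row_free N /\ (N <= kermx (M' *m w^T))%MS.
  apply: row_free_exists; rewrite mxrank_ker.
  by rewrite -[X in (X <= _)%N](subn1 r.+1) leq_sub2l// rank_leq_col.
have {NK} NMw : N *m M' *m w^T = 0 by rewrite -mulmxA; exact/sub_kermxP.
pose Q : 'M[R]_(1 + r) := col_mx w N.
have QE (B : 'M[R]_r.+1) : B^T = B -> Q *m B *m Q^T =
    block_mx ((w *m B *m w^T) 0 0)%:M (N *m B *m w^T)^T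
             (N *m B *m w^T) (N *m B *m N^T).
  move=> Bsym; rewrite tr_col_mx mul_col_mx mul_col_row -mx11_scalar.
  by rewrite !trmx_mul trmxK Bsym mulmxA.
have NVfree : row_free (N *m V) by rewrite /row_free mxrankMfree.
have NVE B : N *m (V *m B *m V^T) *m N^T = N *m V *m B *m (N *m V)^T.
  by rewrite trmx_mul !mulmxA.
have Qdet2 B : \det (Q *m B *m Q^T) = \det Q ^+ 2 * \det B.
  by rewrite !det_mulmx det_tr mulrAC expr2.
have NMP : sym_posdef (N *m M' *m N^T) by exact: sym_posdef_congr.
have NAP : sym_posdef (N *m A' *m N^T) by exact: sym_posdef_congr.
have QM : \det Q ^+ 2 * \det M' =
    (w *m M' *m w^T) 0 0 * \det (N *m M' *m N^T).
  rewrite -Qdet2 QE// NMw trmx0.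
  by rewrite det_ublock det_scalar1.
have QA : \det Q ^+ 2 * \det A' <=
    (w *m A' *m w^T) 0 0 * \det (N *m A' *m N^T).
  by rewrite -Qdet2 QE// fischer_det.
(* Invertibility of [Q] is read off from [QM], whose right-hand side is positive. *)
have Q0 : 0 < \det Q ^+ 2.
  rewrite -(pmulr_lgt0 _ (sym_posdef_det_gt0 MP')) QM.
  by rewrite mulr_gt0// sym_posdef_det_gt0.
rewrite -(ler_pM2l Q0) -/A' (le_trans QA)// -/M' mulrCA QM.
rewrite (bigD1 (Ordinal rn))//=.
rewrite (eq_bigl (fun i : 'I_n => (i < r)%N)); last first.
  move=> i; rewrite -val_eqE/= ltnS; case: ltngtP => //.
have := IH (N *m V) NVfree (ltnW rn); rewrite -!NVE -/A' -/M' => IH'.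
rewrite [leRHS](_ : _ = (l (Ordinal rn) * (w *m M' *m w^T) 0 0) *
  (\prod_(i < n | (i < r)%N) l i * \det (N *m M' *m N^T))); last by ring.
apply: ler_pM => //; last exact/ltW/sym_posdef_det_gt0.
by have := sym_posdef_ge0 w^T AP'; rewrite trmxK.
Qed.

End generalized_rayleigh.

(** * Integration over column vectors *)

Section measurability.
Variables (d : measure_display) (T : measurableType d) (R : realType).

Lemma measurable_mulmx_cV p k (A : 'M[R]_(p, k)) (f : T -> 'cV[R]_k) :
  measurable_fun setT f -> measurable_fun setT (fun t => A *m f t).
Proof.
move=> /measurable_fun_cVP mf; apply/measurable_fun_cVP => i.
under eq_fun do rewrite mxE.
by apply: measurable_sum => j; exact: measurable_funM.
Qed.

Lemma measurable_add_cV k (f g : T -> 'cV[R]_k) :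
  measurable_fun setT f -> measurable_fun setT g ->
  measurable_fun setT (fun t => f t + g t).
Proof.
move=> /measurable_fun_cVP mf /measurable_fun_cVP mg.
apply/measurable_fun_cVP => i; under eq_fun do rewrite mxE.
exact: measurable_funD.
Qed.

Lemma measurable_opp_cV k (f : T -> 'cV[R]_k) :
  measurable_fun setT f -> measurable_fun setT (fun t => - f t).
Proof.
move=> /measurable_fun_cVP mf; apply/measurable_fun_cVP => i.
by under eq_fun do rewrite mxE; exact: measurableT_comp.
Qed.

Lemma measurable_sub_cV k (f g : T -> 'cV[R]_k) :
  measurable_fun setT f -> measurable_fun setT g ->
  measurable_fun setT (fun t => f t - g t).
Proof. by move=> mf mg; apply: measurable_add_cV => //; exact: measurable_opp_cV. Qed.

Lemma measurable_col_mx p k (f : T -> 'cV[R]_p) (g : T -> 'cV[R]_k) :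
  measurable_fun setT f -> measurable_fun setT g ->
  measurable_fun setT (fun t => col_mx (f t) (g t)).
Proof.
move=> /measurable_fun_cVP mf /measurable_fun_cVP mg.
apply/measurable_fun_cVP => i; under eq_fun do rewrite mxE.
by case: (fintype.split i).
Qed.

Lemma measurable_quad k (Q : 'M[R]_k) (f : T -> 'cV[R]_k) :
  measurable_fun setT f ->
  measurable_fun setT (fun t => ((f t)^T *m Q *m f t) 0 0).
Proof.
move=> mf; have /measurable_fun_cVP mQf := measurable_mulmx_cV Q mf.
move/measurable_fun_cVP : mf => mf; under eq_fun do rewrite -mulmxA mxE.
apply: measurable_sum => j; under eq_fun do rewrite mxE.
exact: measurable_funM.
Qed.

End measurability.

Section lebesgue_integrals.
Variable R : realType.
Local Notation mu := (@lebesgue_measure R).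
Local Notation mu_ := (@lebesgue_cV R).

Lemma ge0_integral_cons_cV k (f : 'cV[R]_k.+1 -> \bar R) :
  measurable_fun setT f -> (forall v, 0 <= f v)%E ->
  (\int[mu_ k.+1]_v f v = \int[mu]_t \int[mu_ k]_v f (cons_cV (t, v)))%E.
Proof.
move=> mf f0 /=; rewrite ge0_integral_pushforward//.
  rewrite preimage_setT fubini_tonelli1// => [|x]; last exact: f0.
  by apply: measurableT_comp => //; exact: measurable_cons_cV.
exact: measurable_cons_cV.
Qed.

(** The image of Lebesgue measure under a translation has the same value on half-open intervals,
    hence equals Lebesgue measure. *)
Lemma ge0_integral_shift (c : R) (f : R -> \bar R) :
  measurable_fun setT f -> (forall x, 0 <= f x)%E ->
  (\int[mu]_x f (x + c)%R = \int[mu]_x f x)%E.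
Proof.
move=> mf f0.
have mc : measurable_fun setT ((+%R^~ c) : measurableTypeR R -> measurableTypeR R).
  exact: measurable_funD.
have := @ge0_integral_pushforward _ _ _ _ R _ mc mu setT f measurableT mf.
rewrite preimage_setT => <-//.
apply: eq_measure_integral => //= A mA _.
apply/esym/(@lebesgue_measure_unique R (pushforward mu _)) => //= _ [[a b]] _ <-.
rewrite /pushforward /=.
rewrite (_ : _ @^-1` _ = `]a - c, b - c]%classic); last first.
  by apply/seteqP; split => x /=; rewrite !in_itv/= ltrBlDr lerBrDr.
rewrite !lebesgue_measure_itv/= !lte_fin ltrD2r.
by rewrite -!EFinD opprB addrA subrK.
Qed.

Lemma measurable_integral_cV d (T : measurableType d) k
    (f : T -> 'cV[R]_k -> \bar R) :
  measurable_fun setT (fun p => f p.1 p.2) -> (forall t v, 0 <= f t v)%E ->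
  measurable_fun setT (fun t => \int[mu_ k]_v f t v)%E.
Proof.
move=> mf f0.
exact: (@measurable_fun_fubini_tonelli_F _ _ _ _ _ _ (fun p => f p.1 p.2)).
Qed.

Lemma ge0_integral_shift_cV k (c : 'cV[R]_k) (f : 'cV[R]_k -> \bar R) :
  measurable_fun setT f -> (forall v, 0 <= f v)%E ->
  (\int[mu_ k]_v f (v + c)%R = \int[mu_ k]_v f v)%E.
Proof.
elim: k c f => [|k IH] c f mf f0.
  by apply: eq_integral => v _; congr f; apply/colP => -[].
rewrite !ge0_integral_cons_cV//; last first.
  by apply: measurableT_comp => //; apply: measurable_add_cV.
pose c' := \col_i c (lift ord0 i) 0.
have consD t v : cons_cV (t, v) + c = cons_cV (t + c ord0 0, v + c').
  apply/colP => i; rewrite mxE !cons_cVE.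
  by case: (unliftP ord0 i) => [j|] -> //; rewrite !mxE.
have mcons t : measurable_fun setT (fun v : 'cV[R]_k => f (cons_cV (t, v))).
  apply: measurableT_comp => //.
  apply: (measurableT_comp (@measurable_cons_cV R k)); exact: measurable_pair1.
under eq_integral => t _.
  under eq_integral do rewrite consD.
  rewrite (IH c' (fun v => f (cons_cV (t + c ord0 0, v))))//.
  over.
rewrite (@ge0_integral_shift (c ord0 0)
  (fun t => \int[mu_ k]_v f (cons_cV (t, v)))%E)//.
  apply: measurable_integral_cV => //.
  apply: measurableT_comp => //; under eq_fun do rewrite -surjective_pairing.
  exact: measurable_cons_cV.
by move=> t; exact: integral_ge0.
Qed.

Lemma ge0_integral_col_mx p k (f : 'cV[R]_(p + k) -> \bar R) :
  measurable_fun setT f -> (forall v, 0 <= f v)%E ->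
  (\int[mu_ (p + k)]_v f v = \int[mu_ p]_x \int[mu_ k]_y f (col_mx x y))%E.
Proof.
elim: p f => [|p IH] f mf f0.
  rewrite integral_dirac//; last first.
    apply: measurable_integral_cV => //.
    apply: measurableT_comp => //; apply: measurable_col_mx.
      exact: measurable_fst.
    exact: measurable_snd.
  rewrite diracE mem_set// mul1e; apply: eq_integral => v _.
  congr f; apply/esym/colP => i; rewrite mxE; case: splitP => [[]//|j ij].
  by congr (v _ _); apply/val_inj.
rewrite [LHS]ge0_integral_cons_cV// ge0_integral_cons_cV//; last 2 first.
- apply: measurable_integral_cV => //.
  apply: measurableT_comp => //; apply: measurable_col_mx.
    exact: measurable_fst.
  exact: measurable_snd.
- by move=> v; exact: integral_ge0.
apply: eq_integral => t _; rewrite IH//; last first.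
  apply: measurableT_comp => //.
  apply: (measurableT_comp (@measurable_cons_cV R _)); exact: measurable_pair1.
apply: eq_integral => x _; apply: eq_integral => y _; congr f.
(* [p.+1 + k] reduces to [(p + k).+1], so the cast in the associativity of stacking is an
   identity. *)
by rewrite /cons_cV/= col_mxA; exact: castmx_id.
Qed.

End lebesgue_integrals.

Lemma ge0_integralMl d (T : measurableType d) (R : realType)
    (nu : {measure set T -> \bar R}) (c : R) (f : T -> R) :
  0 <= c -> measurable_fun setT f -> (forall x, 0 <= f x) ->
  (\int[nu]_x (c * f x)%:E = c%:E * \int[nu]_x (f x)%:E)%E.
Proof.
move=> c0 mf f0; under eq_integral do rewrite EFinM.
apply: ge0_integralZl_EFin => //; last exact/measurable_EFinP.
by move=> x _; rewrite lee_fin.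
Qed.

Lemma measurable_expR_quad d (T : measurableType d) (R : realType) k
    (Q : 'M[R]_k) (f : T -> 'cV[R]_k) :
  measurable_fun setT f ->
  measurable_fun setT (fun t => expR (- ((f t)^T *m Q *m f t) 0 0 / 2)).
Proof.
move=> mf; apply: measurableT_comp => //; apply: measurable_funM => //.
by apply: measurableT_comp => //; exact: measurable_quad.
Qed.

Section gaussian_integrals.
Variable R : realType.
Local Notation mu := (@lebesgue_measure R).
Local Notation mu_ := (@lebesgue_cV R).

Lemma measurable_expR_sqr (a b : R) :
  measurable_fun setT (fun t : R => expR (- (a * (t + b) ^+ 2) / 2)).
Proof.
apply: measurableT_comp => //; apply: measurable_funM => //.
apply: measurableT_comp => //; apply: measurable_funM => //.
by apply: measurable_funX; exact: measurable_funD.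
Qed.

Lemma integral_expR_sqr (a b : R) : 0 < a ->
  (\int[mu]_t (expR (- (a * (t + b) ^+ 2) / 2))%:E)%E =
  (Num.sqrt (2 * pi / a))%:E.
Proof.
(* [s] is the standard deviation for which the integrand is, up to its peak value, the normal
   density with mean [- b]. *)
move=> a0; pose s : R := (Num.sqrt a)^-1.
have s0 : s != 0 by rewrite invr_eq0 gt_eqF// sqrtr_gt0.
have s2 : s ^+ 2 = a^-1 by rewrite exprVn sqr_sqrtr// ltW.
have peak0 : 0 < normal_peak s by exact: normal_peak_gt0.
have h : (\int[mu]_t (normal_peak s * expR (- (a * (t + b) ^+ 2) / 2))%:E)%E = 1%E.
  rewrite -(integral_normal_pdf (- b) s); apply: eq_integral => t _.
  rewrite normal_pdfE// -[RHS]/(normal_peak s * normal_fun (- b) s t)%:E.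
  rewrite /normal_fun opprK s2.
  by congr (_ * expR _)%:E; field; rewrite gt_eqF.
move: h; rewrite ge0_integralMl; last 3 first.
- exact: ltW.
- exact: measurable_expR_sqr.
- by move=> t; exact: expR_ge0.
move/(congr1 (fun x => (normal_peak s)^-1%:E * x)%E).
rewrite muleA -EFinM mulVf ?gt_eqF// mul1e mule1 => ->.
by rewrite /normal_peak invrK s2 -mulr_natl mulrA mulrAC.
Qed.

(** Induction on the dimension. For fixed remaining coordinates v the square completed by
    [schur_quad] is centred at [- b v], so the first coordinate has to be integrated first, whence
    the exchange of integrals; the Schur complement is left for the induction hypothesis. *)
Lemma integral_expR_quad k (Q : 'M[R]_k) : sym_posdef Q ->
  (\int[mu_ k]_v (expR (- (v^T *m Q *m v) 0 0 / 2))%:E)%E =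
  (Num.sqrt ((2 * pi) ^+ k / \det Q))%:E.
Proof.
elim: k Q => [|k IH] Q QP.
  rewrite integral_dirac//; last first.
    by apply/measurable_EFinP; exact: measurable_expR_quad.
  rewrite diracE mem_set// mul1e mulmx0 mxE oppr0 mul0r expR0 det_mx00.
  by rewrite expr0 divr1 sqrtr1.
rewrite ge0_integral_cons_cV; last 2 first.
- by apply/measurable_EFinP; exact: measurable_expR_quad.
- by move=> v; rewrite lee_fin expR_ge0.
rewrite (@fubini_tonelli _ _ _ _ R mu (mu_ k)
  (fun p => (expR (- ((cons_cV p)^T *m Q *m cons_cV p) 0 0 / 2))%:E)); last 2 first.
- apply/measurable_EFinP; apply: measurable_expR_quad.
  exact: measurable_cons_cV.
- by move=> v; rewrite lee_fin expR_ge0.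
have a0 := schur_pivot_gt0 QP.
have SP := schur_sym_posdef QP.
pose b (v : 'cV[R]_k) : R := (schur_pivot Q)^-1 * ((schur_col Q)^T *m v) 0 0.
have inner (v : 'cV[R]_k) :
    (\int[mu]_t (expR (- ((cons_cV (t, v))^T *m Q *m cons_cV (t, v)) 0 0 / 2))%:E)%E
    = (Num.sqrt (2 * pi / schur_pivot Q) *
       expR (- (v^T *m schur_compl Q *m v) 0 0 / 2))%:E.
  transitivity (\int[mu]_t (expR (- (v^T *m schur_compl Q *m v) 0 0 / 2) *
      expR (- (schur_pivot Q * (t + b v) ^+ 2) / 2))%:E)%E.
    apply: eq_integral => t _; rewrite (@schur_quad _ _ Q QP) /= mxE eqxx mulr1n.
    by rewrite opprD mulrDl expRD mulrC.
  rewrite ge0_integralMl; last 3 first.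
  - exact: expR_ge0.
  - exact: measurable_expR_sqr.
  - by move=> t; exact: expR_ge0.
  by rewrite integral_expR_sqr// -EFinM mulrC.
under eq_integral do rewrite inner.
rewrite ge0_integralMl; last 3 first.
- exact: sqrtr_ge0.
- exact: measurable_expR_quad.
- by move=> t; exact: expR_ge0.
rewrite IH// -EFinM -sqrtrM; last by rewrite divr_ge0 ?mulr_ge0 ?pi_ge0 ?ltW.
congr (Num.sqrt _)%:E; rewrite (schur_det QP) exprS invfM.
ring.
Qed.

Variables (k : nat) (m : 'cV[R]_k) (C : 'M[R]_k).

Lemma measurable_gaussian_pdf d (T : measurableType d) (f : T -> 'cV[R]_k) :
  measurable_fun setT f ->
  measurable_fun setT (fun t => gaussian_pdf m C (f t)).
Proof.
move=> mf; apply: measurable_funM => //; apply: measurable_expR_quad.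
exact: measurable_sub_cV.
Qed.

Hypothesis CP : sym_posdef C.

Lemma gaussian_peak_gt0 : 0 < Num.sqrt ((2 * pi) ^+ k * \det C).
Proof.
by rewrite sqrtr_gt0 mulr_gt0 ?sym_posdef_det_gt0// exprn_gt0// mulr_gt0 ?pi_gt0.
Qed.

Lemma gaussian_pdf_gt0 z : 0 < gaussian_pdf m C z.
Proof. by rewrite mulr_gt0 ?expR_gt0// invr_gt0 gaussian_peak_gt0. Qed.

Lemma integral_gaussian_pdf :
  (\int[mu_ k]_z (gaussian_pdf m C z)%:E)%E = 1%E.
Proof.
have peak0 := gaussian_peak_gt0.
rewrite ge0_integralMl; last 3 first.
- by rewrite invr_ge0 ltW.
- by apply: measurable_expR_quad; exact: measurable_sub_cV.
- by move=> t; exact: expR_ge0.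
rewrite (@ge0_integral_shift_cV R k (- m)
  (fun z => (expR (- (z^T *m invmx C *m z) 0 0 / 2))%:E)); last 2 first.
- by apply/measurable_EFinP; exact: measurable_expR_quad.
- by move=> v; rewrite lee_fin expR_ge0.
rewrite integral_expR_quad; last exact: sym_posdef_invmx.
by rewrite det_inv invrK -EFinM mulVf// gt_eqF.
Qed.

End gaussian_integrals.

(** * Densities and Gaussian random vectors *)

Section densities.
Context {R : realType} {d : measure_display} {T : measurableType d}.
Variable P : probability T R.
Local Notation mu_ := (@lebesgue_cV R).

(** The law of Z is dominated by Lebesgue measure, and its Radon-Nikodym derivative equals f almost
    everywhere because both have the same integral over every measurable set. *)
Lemma has_pdf_integral k (Z : T -> 'cV[R]_k) f (h : 'cV[R]_k -> \bar R) :
  measurable_fun setT Z -> has_pdf P Z f ->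
  measurable_fun setT h -> (forall z, 0 <= h z)%E ->
  (\int[P]_t h (Z t) = \int[mu_ k]_z (h z * (f z)%:E))%E.
Proof.
move=> mZ [mf f0 PZ] mh h0.
pose Z' : {mfun T >-> 'cV[R]_k} := HB.pack Z (isMeasurableFun.Build _ _ _ _ _ mZ).
pose nu := distribution P Z'.
have numu : nu `<< mu_ k.
  apply/null_content_dominatesP => A mA A0; rewrite /nu /distribution /pushforward.
  rewrite [LHS]PZ//; apply: null_set_integral => //.
  by apply: measurable_funTS; exact/measurable_EFinP.
transitivity (\int[nu]_z h z)%E.
  by rewrite ge0_integral_distribution.
rewrite -(Radon_Nikodym_SigmaFinite.change_of_variables numu)//.
have mRN := Radon_Nikodym_SigmaFinite.f_integrable numu.
apply: ae_eq_integral => //.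
- by apply: emeasurable_funM => //; exact: measurable_int mRN.
- by apply: emeasurable_funM => //; exact/measurable_EFinP.
apply: ae_eqe_mul2l; apply: integral_ae_eq => //.
  exact/measurable_EFinP.
move=> A _ mA; rewrite -PZ//.
by rewrite -(Radon_Nikodym_SigmaFinite.f_integral numu).
Qed.

Lemma probability_preimage_indic k (Z : T -> 'cV[R]_k) A :
  measurable_fun setT Z -> measurable A ->
  (P (Z @^-1` A) = \int[P]_t (\1_A (Z t))%:E)%E.
Proof.
move=> mZ mA.
have mZA : measurable (Z @^-1` A) by rewrite -[_ @^-1` _]setTI; exact: mZ.
by rewrite -(setIT (Z @^-1` A)) -integral_indic// preimage_indic.
Qed.

Lemma integral_indic_mul k (A : set 'cV[R]_k) (g : 'cV[R]_k -> R) :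
  measurable A ->
  (\int[mu_ k]_(z in A) (g z)%:E = \int[mu_ k]_z ((\1_A z)%:E * (g z)%:E))%E.
Proof.
move=> mA; rewrite integral_mkcond; apply: eq_integral => z _.
by rewrite patchE indicE; case: ifPn => _; rewrite ?mul1e ?mul0e.
Qed.

Lemma has_pdf_unique k (Z : T -> 'cV[R]_k) f g :
  has_pdf P Z f -> has_pdf P Z g ->
  ae_eq (mu_ k) setT (EFin \o f) (EFin \o g).
Proof.
move=> [mf f0 Pf] [mg g0 Pg]; apply: integral_ae_eq => //.
- apply/integrableP; split; first exact/measurable_EFinP.
  under eq_integral do rewrite gee0_abs ?lee_fin//.
  by rewrite -Pf// preimage_setT probability_setT ltry.
- exact/measurable_EFinP.
- by move=> A _ mA; rewrite -Pf// Pg.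
Qed.

End densities.

Section bilinear_forms.
Variable R : realType.

(** A named scalar form, so that exponents can be expanded by biadditivity and compared with
    [ring]. *)
Definition bilform p k (Q : 'M[R]_(p, k)) (x : 'cV[R]_p) (y : 'cV[R]_k) : R :=
  (x^T *m Q *m y) 0 0.

Lemma bilformDl p k (Q : 'M[R]_(p, k)) x x' y :
  bilform Q (x + x') y = bilform Q x y + bilform Q x' y.
Proof. by rewrite /bilform [_^T]linearD/= !mulmxDl mxE. Qed.

Lemma bilformDr p k (Q : 'M[R]_(p, k)) x y y' :
  bilform Q x (y + y') = bilform Q x y + bilform Q x y'.
Proof. by rewrite /bilform mulmxDr mxE. Qed.

Lemma bilformNl p k (Q : 'M[R]_(p, k)) x y : bilform Q (- x) y = - bilform Q x y.
Proof. by rewrite /bilform [_^T]linearN/= !mulNmx mxE. Qed.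

Lemma bilformNr p k (Q : 'M[R]_(p, k)) x y : bilform Q x (- y) = - bilform Q x y.
Proof. by rewrite /bilform mulmxN mxE. Qed.

Lemma bilformC k (Q : 'M[R]_k) x y : Q^T = Q -> bilform Q x y = bilform Q y x.
Proof.
move=> Qsym; rewrite /bilform -[in LHS](trmxK (x^T *m Q *m y)) [LHS]mxE.
by rewrite !trmx_mul trmxK Qsym mulmxA.
Qed.

Lemma gaussian_pdfE k (m z : 'cV[R]_k) (C : 'M[R]_k) : gaussian_pdf m C z =
  (Num.sqrt ((2 * pi) ^+ k * \det C))^-1 *
  expR (- bilform (invmx C) (z - m) (z - m) / 2).
Proof. by []. Qed.

(** [K] is the regression matrix of Z on [L *m Z]: it is a right inverse of [L], and pairing y with
    [K *m x] under [invmx C] is pairing [L *m y] with x under [invmx S]. With eps = e - m and u = w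
    - L m, both sums of quadratic forms become |eps|^2 - 2 <L eps, u> + 2 |u|^2, the first norm
    being that of [invmx C] and the other terms those of [invmx S]. *)
Lemma gaussian_pdf_transport n r (C : 'M[R]_n) (L : 'M[R]_(r, n))
    (m e : 'cV[R]_n) (w : 'cV[R]_r) :
  sym_posdef C -> row_free L ->
  let S := L *m C *m L^T in
  let K := C *m L^T *m invmx S in
  gaussian_pdf 0 S (w - L *m e) * gaussian_pdf m C (e + K *m (w - L *m e)) =
  gaussian_pdf (L *m m) S w * gaussian_pdf m C (e - K *m (w - L *m m)).
Proof.
move=> CP Lfree S K.
have SP : sym_posdef S by exact: sym_posdef_congr.
have Su := sym_posdef_unitmx SP; have Cu := sym_posdef_unitmx CP.
have [SVsym _] := sym_posdef_invmx SP; have [CVsym _] := sym_posdef_invmx CP.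
rewrite !gaussian_pdfE mulrACA [RHS]mulrACA -!expRD.
congr (_ * expR _); rewrite -!mulrDl -!opprD; congr (- _ / _).
pose eps := e - m; pose u := w - L *m m.
have -> : w - L *m e - 0 = u - L *m eps.
  by rewrite /u /eps subr0 mulmxBr opprB addrA subrK.
have -> : e + K *m (w - L *m e) - m = eps + K *m (u - L *m eps).
  rewrite addrAC -/eps; congr (_ + _ *m _).
  by rewrite /u /eps mulmxBr opprB addrA subrK.
have -> : e - K *m (w - L *m m) - m = eps - K *m u by rewrite addrAC.
rewrite -/u; clearbody eps u.
have BK y x : bilform (invmx C) y (K *m x) = bilform (invmx S) (L *m y) x.
  rewrite /bilform -mulmxA (_ : invmx C *m (K *m x) = L^T *m (invmx S *m x)).
    by rewrite trmx_mul !mulmxA.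
  by rewrite /K !mulmxA mulVmx// mul1mx.
have LK x : L *m (K *m x) = x by rewrite /K !mulmxA mulmxV// mul1mx.
rewrite !(bilformDl, bilformDr, bilformNl, bilformNr, BK, LK).
rewrite !(bilformC (K *m _) _ CVsym) !BK.
rewrite !(bilformDl, bilformDr, bilformNl, bilformNr, BK, LK).
rewrite (bilformC u _ SVsym); ring.
Qed.

End bilinear_forms.

Section gaussian_transform.
Context {R : realType} {d : measure_display} {T : measurableType d}.
Variable P : probability T R.
Local Notation mu_ := (@lebesgue_cV R).

(* Integrating against the weight [gaussian_pdf 0 S] and shifting turns an
   integral over R^n of a function of [L *m e] into one over R^r, so that no
   change of variables formula for determinants is needed. *)
Lemma gaussian_mulmx n r (Z : T -> 'cV[R]_n) m (C : 'M[R]_n) (L : 'M[R]_(r, n)) :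
  measurable_fun setT Z -> sym_posdef C -> row_free L -> gaussian P Z m C ->
  gaussian P (fun t => L *m Z t) (L *m m) (L *m C *m L^T).
Proof.
move=> mZ CP Lfree ZG; set S := L *m C *m L^T.
have SP : sym_posdef S by exact: sym_posdef_congr.
have pdf_ge0 k (m' : 'cV[R]_k) C' z : sym_posdef C' -> 0 <= gaussian_pdf m' C' z.
  by move=> CP'; exact/ltW/gaussian_pdf_gt0.
split.
- exact: measurable_gaussian_pdf.
- by move=> z; exact: pdf_ge0.
move=> A mA.
have mLZ : measurable_fun setT (fun t => L *m Z t) by exact: measurable_mulmx_cV.
rewrite (probability_preimage_indic P mLZ mA) integral_indic_mul//.
pose h w : R := \1_A w; have h0 w : 0 <= h w by rewrite /h indicE; case: (_ \in _).
have mh : measurable_fun setT h by exact: measurable_indic.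
have mhf d' (T' : measurableType d') f : measurable_fun [set: T'] f ->
    measurable_fun setT (fun t => h (f t)) by move=> mf; exact: measurableT_comp.
rewrite (has_pdf_integral (h := fun e => (h (L *m e))%:E) mZ ZG)//; last 2 first.
- by apply/measurable_EFinP; apply: mhf; exact: measurable_mulmx_cV.
- by move=> e; rewrite lee_fin.
pose K := C *m L^T *m invmx S.
pose f := gaussian_pdf m C; pose phi := gaussian_pdf (0 : 'cV_r) S.
have f0 e : 0 <= f e by exact: pdf_ge0.
have phi0 e : 0 <= phi e by exact: pdf_ge0.
have mf d' (T' : measurableType d') (g : T' -> _) : measurable_fun setT g ->
    measurable_fun setT (fun t => f (g t)).
  by move=> mg; exact: measurable_gaussian_pdf.
have mphi d' (T' : measurableType d') (g : T' -> _) : measurable_fun setT g ->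
    measurable_fun setT (fun t => phi (g t)).
  by move=> mg; exact: measurable_gaussian_pdf.
have LK x : L *m (K *m x) = x.
  by rewrite /K !mulmxA mulmxV ?mul1mx//; exact: sym_posdef_unitmx.
have mfst := @measurable_fst _ _ 'cV[R]_r 'cV[R]_n.
have msnd := @measurable_snd _ _ 'cV[R]_r 'cV[R]_n.
have mhLf : measurable_fun setT (fun e => h (L *m e) * f e).
  apply: measurable_funM; last exact: mf.
  by apply: mhf; exact: measurable_mulmx_cV.
have mjoint : measurable_fun setT
    (fun p : 'cV[R]_r * 'cV[R]_n => h (L *m p.2 + p.1) * f (p.2 + K *m p.1)).
  apply: measurable_funM.
    by apply: mhf; apply: measurable_add_cV => //; exact: measurable_mulmx_cV.
  by apply: mf; apply: measurable_add_cV => //; exact: measurable_mulmx_cV.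
(* The weight [phi] has integral 1, so it can be inserted; then, for each w, e is shifted by
   [K *m w], which changes [L *m e] into [L *m e + w]. *)
transitivity (\int[mu_ r]_w \int[mu_ n]_e
    (phi w * (h (L *m e + w) * f (e + K *m w)))%:E)%E.
  transitivity (\int[mu_ r]_w
      ((\int[mu_ n]_e (h (L *m e) * f e)%:E) * (phi w)%:E))%E.
    rewrite ge0_integralZl//; last 3 first.
    - by apply/measurable_EFinP; exact: mphi.
    - by move=> w _; rewrite lee_fin.
    - by apply: integral_ge0 => e _; rewrite lee_fin mulr_ge0.
    by rewrite integral_gaussian_pdf// mule1; under eq_integral do rewrite -EFinM.
  apply: eq_integral => w _.
  rewrite -(@ge0_integral_shift_cV R n (K *m w)); last 2 first.
  - exact/measurable_EFinP.
  - by move=> e; rewrite lee_fin mulr_ge0.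
  under eq_integral do rewrite mulmxDr LK.
  rewrite muleC ge0_integralMl//; last by move=> e; rewrite mulr_ge0.
  exact: (measurableT_comp mjoint (measurable_pair1 w)).
rewrite (@fubini_tonelli _ _ _ _ R (mu_ r) (mu_ n)
  (fun p => (phi p.1 * (h (L *m p.2 + p.1) * f (p.2 + K *m p.1)))%:E)); last 2 first.
- by apply/measurable_EFinP; apply: measurable_funM => //; exact: mphi.
- by move=> p; rewrite lee_fin !mulr_ge0.
(* With e fixed, shifting w by [- (L *m e)] makes the argument of [h] equal to w alone, and the
   product of densities takes the form treated by [gaussian_pdf_transport]. *)
under eq_integral => e _.
  rewrite -(@ge0_integral_shift_cV R r (- (L *m e))); last 2 first.
  - apply/measurable_EFinP; apply: measurable_funM; first exact: (mphi _ _ id).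
    exact: (measurableT_comp mjoint (measurable_pair2 e)).
  - by move=> p; rewrite lee_fin !mulr_ge0.
  over.
transitivity (\int[mu_ n]_e \int[mu_ r]_w
   (h w * gaussian_pdf (L *m m) S w * f (e - K *m (w - L *m m)))%:E)%E.
  apply: eq_integral => e _; apply: eq_integral => w _; congr EFin.
  have := gaussian_pdf_transport m e w CP Lfree; rewrite -/S -/K -/f -/phi => E.
  rewrite (_ : L *m e + (w - L *m e) = w); last by rewrite addrCA subrr addr0.
  by rewrite mulrCA E mulrA.
rewrite -(@fubini_tonelli _ _ _ _ R (mu_ r) (mu_ n) (fun p => (h p.1 *
   gaussian_pdf (L *m m) S p.1 * f (p.2 - K *m (p.1 - L *m m)))%:E)); last 2 first.
- apply/measurable_EFinP; apply: measurable_funM.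
    by apply: measurable_funM; [exact: mhf|exact: measurable_gaussian_pdf].
  apply: mf; apply: measurable_sub_cV => //.
  by apply: measurable_mulmx_cV; exact: measurable_sub_cV.
- by move=> p; rewrite lee_fin !mulr_ge0// pdf_ge0.
(* In the remaining integral over e only a translate of [f] occurs; it has total mass 1. *)
apply: eq_integral => w _; rewrite /= ge0_integralMl; last 3 first.
- by rewrite mulr_ge0// pdf_ge0.
- by apply: mf; exact: measurable_sub_cV.
- by move=> e; exact: f0.
rewrite (@ge0_integral_shift_cV R n (- (K *m (w - L *m m))) (fun e => (f e)%:E)).
- by rewrite integral_gaussian_pdf// mule1 EFinM.
- by apply/measurable_EFinP; exact: mf.
- by move=> e; rewrite lee_fin.
Qed.

End gaussian_transform.

Section gaussian_stack.
Context {R : realType} {d : measure_display} {T : measurableType d}.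
Variable P : probability T R.
Local Notation mu_ := (@lebesgue_cV R).

Lemma block_diag_sym_posdef p k (C : 'M[R]_p) (D : 'M[R]_k) :
  sym_posdef C -> sym_posdef D -> sym_posdef (block_mx C 0 0 D).
Proof.
move=> CP DP; have [Csym Cpos] := CP; have [Dsym Dpos] := DP; split.
  by rewrite tr_block_mx Csym Dsym !trmx0.
move=> v; rewrite -(vsubmxK v); set x := usubmx v; set y := dsubmx v => xy0.
rewrite tr_col_mx mul_row_block !mulmx0 addr0 add0r mul_row_col mxE.
have [x0|x0] := eqVneq x 0.
  have y0 : y != 0.
    by apply: contra_neq xy0 => y0; rewrite x0 y0 col_mx0.
  by rewrite ltr_wpDl ?Dpos ?sym_posdef_ge0.
by rewrite ltr_pwDl ?Cpos ?sym_posdef_ge0.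
Qed.

Lemma gaussian_pdf_col_mx p k (m : 'cV[R]_p) (m' : 'cV[R]_k) C D x y :
  sym_posdef C -> sym_posdef D ->
  gaussian_pdf (col_mx m m') (block_mx C 0 0 D) (col_mx x y) =
  gaussian_pdf m C x * gaussian_pdf m' D y.
Proof.
move=> CP DP; rewrite !gaussian_pdfE mulrACA -expRD; congr (_ * expR _).
  rewrite -invfM -sqrtrM; last first.
    by rewrite mulr_ge0 ?exprn_ge0 ?mulr_ge0 ?pi_ge0// ltW// sym_posdef_det_gt0.
  by rewrite det_ublock exprD mulrACA.
rewrite invmx_block_diag; last first.
  by rewrite block_diag_mx_unit !sym_posdef_unitmx.
rewrite -mulrDl -opprD; congr (- _ / _).
rewrite /bilform opp_col_mx add_col_mx tr_col_mx mul_row_block.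
by rewrite !mulmx0 addr0 add0r mul_row_col mxE.
Qed.

(** By independence the law of the pair agrees with the product of the two laws on rectangles, hence
    everywhere. Integrating against one density after the other then gives the product density,
    which is the block diagonal Gaussian one. *)
Lemma gaussian_col_mx p k (Z0 : T -> 'cV[R]_p) (Z1 : T -> 'cV[R]_k) m m' C D :
  measurable_fun setT Z0 -> measurable_fun setT Z1 ->
  sym_posdef C -> sym_posdef D ->
  gaussian P Z0 m C -> gaussian P Z1 m' D -> independent_vectors P Z0 Z1 ->
  gaussian P (fun t => col_mx (Z0 t) (Z1 t)) (col_mx m m') (block_mx C 0 0 D).
Proof.
move=> mZ0 mZ1 CP DP G0 G1 ind; split.
- exact: measurable_gaussian_pdf.
- by move=> z; exact/ltW/gaussian_pdf_gt0/block_diag_sym_posdef.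
move=> A mA; rewrite integral_indic_mul//.
pose h w : R := \1_A w; have h0 w : 0 <= h w by rewrite /h indicE; case: (_ \in _).
have mh d' (T' : measurableType d') f : measurable_fun [set: T'] f ->
    measurable_fun setT (fun t => h (f t)).
  by move=> mf; apply: measurableT_comp => //; exact: measurable_indic.
pose X0 : {mfun T >-> 'cV[R]_p} := HB.pack Z0 (isMeasurableFun.Build _ _ _ _ _ mZ0).
pose X1 : {mfun T >-> 'cV[R]_k} := HB.pack Z1 (isMeasurableFun.Build _ _ _ _ _ mZ1).
have mZ01 : measurable_fun setT (fun t => (Z0 t, Z1 t)).
  by apply/measurable_fun_pair.
pose X01 : {mfun T >-> ('cV[R]_p * 'cV[R]_k)%type} :=
  HB.pack (fun t => (Z0 t, Z1 t)) (isMeasurableFun.Build _ _ _ _ _ mZ01).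
have mcol : measurable_fun setT
    (fun z : 'cV[R]_p * 'cV[R]_k => col_mx z.1 z.2).
  exact: measurable_col_mx.
have law B : measurable B ->
    (distribution P X0 \x distribution P X1)%E B = distribution P X01 B.
  apply: product_measure_unique => B0 B1 mB0 mB1.
  by rewrite /distribution /pushforward -ind.
pose B := (fun z : 'cV[R]_p * 'cV[R]_k => col_mx z.1 z.2) @^-1` A.
have mB : measurable B by rewrite /B -[_ @^-1` _]setTI; exact: mcol.
pose g0 := gaussian_pdf m C; pose g1 := gaussian_pdf m' D.
have g00 x : 0 <= g0 x by exact/ltW/gaussian_pdf_gt0.
have g10 y : 0 <= g1 y by exact/ltW/gaussian_pdf_gt0.
have mg0 d' (T' : measurableType d') (f : T' -> _) : measurable_fun setT f ->
    measurable_fun setT (fun t => g0 (f t)).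
  by move=> mf; exact: measurable_gaussian_pdf.
have mg1 d' (T' : measurableType d') (f : T' -> _) : measurable_fun setT f ->
    measurable_fun setT (fun t => g1 (f t)).
  by move=> mf; exact: measurable_gaussian_pdf.
have mh_col : measurable_fun setT
    (fun z : 'cV[R]_p * 'cV[R]_k => h (col_mx z.1 z.2)) by exact: mh.
have mh_snd x : measurable_fun setT (fun y : 'cV[R]_k => h (col_mx x y)).
  by apply: mh; apply: measurable_col_mx => //; exact: measurable_cst.
transitivity (\int[(distribution P X0 \x distribution P X1)]_z
    (h (col_mx z.1 z.2))%:E)%E.
  transitivity (distribution P X01 B); first by [].
  by rewrite -law// -[in LHS](setIT B) -integral_indic// preimage_indic.
rewrite fubini_tonelli1//=; last 2 first.
- exact/measurable_EFinP.
- by move=> z; rewrite lee_fin.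
rewrite ge0_integral_distribution/=; last 2 first.
- apply: measurable_fun_fubini_tonelli_F.
    exact/measurable_EFinP.
  by move=> z; rewrite lee_fin.
- by move=> x; apply: integral_ge0 => y _; rewrite lee_fin.
transitivity (\int[P]_t \int[mu_ k]_y (h (col_mx (Z0 t) y) * g1 y)%:E)%E.
  apply: eq_integral => t _.
  rewrite /fubini_F/= ge0_integral_distribution/=; last 2 first.
  - exact/measurable_EFinP.
  - by move=> y; rewrite lee_fin.
  rewrite (has_pdf_integral (h := fun y => (h (col_mx (Z0 t) y))%:E) mZ1 G1)//.
    exact/measurable_EFinP.
  by move=> y; rewrite lee_fin.
have mhg : measurable_fun setT (fun z : 'cV[R]_p * 'cV[R]_k =>
    (h (col_mx z.1 z.2) * g1 z.2)%:E).
  by apply/measurable_EFinP; apply: measurable_funM => //; exact: mg1.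
rewrite (has_pdf_integral (h := fun x => (\int[mu_ k]_y
  (h (col_mx x y) * g1 y)%:E)%E) mZ0 G0); last 2 first.
- by apply: measurable_integral_cV => // x y; rewrite lee_fin mulr_ge0.
- by move=> x; apply: integral_ge0 => y _; rewrite lee_fin mulr_ge0.
rewrite ge0_integral_col_mx; last 2 first.
- under eq_fun do rewrite -EFinM; apply/measurable_EFinP.
  by apply: measurable_funM; [exact: mh|exact: measurable_gaussian_pdf].
- move=> z; rewrite -EFinM lee_fin mulr_ge0// ltW// gaussian_pdf_gt0//.
  exact: block_diag_sym_posdef.
apply: eq_integral => x _.
rewrite muleC -ge0_integralMl//; last 2 first.
- by apply: measurable_funM => //; exact: mg1.
- by move=> y; rewrite mulr_ge0.
apply: eq_integral => y _; rewrite gaussian_pdf_col_mx// -EFinM.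
by rewrite mulrCA.
Qed.

End gaussian_stack.

(** * Entropy *)

Section gaussian_second_moment.
Context {R : realType}.
Local Notation mu_ := (@lebesgue_cV R).

Lemma ge0_integrable_fin d (T : measurableType d) (nu : {measure set T -> \bar R})
    (f : T -> R) (a : R) :
  measurable_fun setT f -> (forall x, 0 <= f x) ->
  (\int[nu]_x (f x)%:E = a%:E)%E -> nu.-integrable setT (EFin \o f).
Proof.
move=> mf f0 fa; apply/integrableP; split; first exact/measurable_EFinP.
under eq_integral do rewrite gee0_abs ?lee_fin//.
by rewrite fa ltry.
Qed.

Lemma integral_expR_scaled_quad k (Q : 'M[R]_k) (s : R) :
  sym_posdef Q -> 0 < s ->
  (\int[mu_ k]_v (expR (- (s ^+ 2 * bilform Q v v) / 2))%:E)%E =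
  (Num.sqrt ((2 * pi) ^+ k / \det Q) / s ^+ k)%:E.
Proof.
move=> QP s0.
have sE (v : 'cV[R]_k) : s ^+ 2 * bilform Q v v = (v^T *m (s ^+ 2 *: Q) *m v) 0 0.
  by rewrite /bilform -scalemxAr -scalemxAl [RHS]mxE.
under eq_integral do rewrite sE.
rewrite integral_expR_quad; last first.
  have [Qsym Qpos] := QP; split; first by rewrite linearZ/= Qsym.
  by move=> v v0; rewrite -sE mulr_gt0 ?exprn_gt0 ?Qpos.
rewrite detZ -exprM mulnC exprM invfM mulrA mulrAC sqrtrM; last first.
  by rewrite divr_ge0 ?exprn_ge0 ?mulr_ge0 ?pi_ge0// ltW// sym_posdef_det_gt0.
by rewrite -exprVn sqrtr_sqr ger0_norm// invr_ge0 exprn_ge0// ltW.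
Qed.

(* For every s > 0, integrating [expR x >= 1 + x] at x = (1 - s^2) q / 2 against
   [expR (- q / 2)] gives c <= c / s^k + (s^2 - 1) M / 2, where M is the integral
   to be computed; this is an equality at s = 1, so the derivatives agree. *)
Lemma integral_quad_expR k (Q : 'M[R]_k) : sym_posdef Q ->
  (\int[mu_ k]_v (bilform Q v v * expR (- bilform Q v v / 2))%:E)%E =
  (k%:R * Num.sqrt ((2 * pi) ^+ k / \det Q))%:E.
Proof.
move=> QP; set c := Num.sqrt _.
pose q v := bilform Q v v; rewrite -/(q _).
have q0 v : 0 <= q v by exact: sym_posdef_ge0.
pose e (s : R) v := expR (- (s ^+ 2 * q v) / 2).
have mq : measurable_fun setT q by exact: measurable_quad.
have me s : measurable_fun setT (e s).
  apply: measurableT_comp => //; apply: measurable_funM => //.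
  by apply: measurableT_comp => //; exact: measurable_funM.
have ie (s : R) : 0 < s -> (mu_ k).-integrable setT (EFin \o e s).
  move=> s0; apply: (@ge0_integrable_fin _ _ (mu_ k) (e s) (c / s ^+ k)) => //.
    by move=> v; exact: expR_ge0.
  exact: integral_expR_scaled_quad.
pose g v := q v * e 1 v.
have gE v : q v * expR (- q v / 2) = g v by rewrite /g /e expr1n mul1r.
under eq_integral do rewrite gE.
have mg : measurable_fun setT g by exact: measurable_funM.
have ig : (mu_ k).-integrable setT (EFin \o g).
  (* The bound x <= exp x at x = 3 q / 8 gives q exp (- 3 q / 8) <= 8 / 3, and the factor left over
     from exp (- q / 2) is exp (- q / 8), that is, [e 2^-1]. *)
  apply: (@le_integrable _ _ _ _ _ measurableT _
    (fun v => (8 / 3)%:E * (e 2^-1 v)%:E)%E).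
  - exact/measurable_EFinP.
  - move=> v _; rewrite -EFinM !abse_EFin lee_fin.
    rewrite !ger0_norm ?mulr_ge0 ?expR_ge0//.
    rewrite /g (_ : e 1 v = expR (- (3 / 8 * q v)) * e 2^-1 v); last first.
      by rewrite /e -expRD; congr expR; field.
    rewrite mulrA ler_wpM2r ?expR_ge0// expRN ler_pdivrMr ?expR_gt0//.
    have := expR_ge1Dx (3 / 8 * q v); lra.
  - by apply: integrableZl => //; exact: ie.
pose M := fine (\int[mu_ k]_v (g v)%:E).
have ME : (\int[mu_ k]_v (g v)%:E)%E = M%:E.
  by rewrite /M fineK//; exact: integrable_fin_num.
clearbody M.
have ec (s : R) : 0 < s -> (\int[mu_ k]_v (e s v)%:E)%E = (c / s ^+ k)%:E.
  exact: integral_expR_scaled_quad.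
have key (s : R) : 0 < s -> c <= c / s ^+ k + (s ^+ 2 - 1) / 2 * M.
  move=> s0; rewrite -lee_fin EFinD [X in (_ <= _ + X)%E]EFinM -ME -(ec s s0).
  have -> : c%:E = (\int[mu_ k]_v (e 1 v)%:E)%E by rewrite ec// expr1n divr1.
  rewrite -integralZl// -integralD//; last 2 first.
  - exact: ie.
  - exact: integrableZl.
  apply: le_integral => //; first exact: ie.
  - by apply: integrableD => //; [exact: ie|exact: integrableZl].
  move=> v _; rewrite /= -EFinM -EFinD lee_fin.
  have -> : e s v = e 1 v * expR (- ((s ^+ 2 - 1) / 2 * q v)).
    by rewrite /e -expRD; congr expR; field.
  rewrite /g; have := expR_ge1Dx (- ((s ^+ 2 - 1) / 2 * q v)).
  move=> /(ler_wpM2l (expR_ge0 (- (1 ^+ 2 * q v) / 2))); rewrite -/(e 1 v); lra.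
(* Multiplying [key] by s^k makes it polynomial: it says p(s) >= - c = p(1) for s > 0. Hence p'(1) =
   M - k c vanishes. *)
pose p : {poly R} := (('X^2 - 1) * (M / 2)%:P - c%:P) * 'X^k.
have pE (s : R) : p.[s] = ((s ^+ 2 - 1) * (M / 2) - c) * s ^+ k by rewrite !hornerE.
have pmin (s : R) : s \in `]0, 2[ -> p.[1] <= p.[s].
  rewrite in_itv/= => /andP[s0 _]; have := key s s0.
  rewrite !pE !expr1n subrr mul0r add0r mulr1 -(ler_pM2r (exprn_gt0 k s0)).
  rewrite mulrDl divfK ?gt_eqF ?exprn_gt0//; lra.
have d1 : is_derive (1 : R) 1 (horner p) 0.
  apply: (@derive1_at_min R _ 0 2) => //.
  by rewrite in_itv/= ltr01 ltr1n.
have := @derive_val _ _ _ _ _ _ _ d1.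
rewrite (@derive_val _ _ _ _ _ _ _ (is_derive_poly p 1)).
rewrite /p derivM !derivB derivM !derivB !derivXn !derivC mulr0 addr0 !subr0.
rewrite !(hornerM, hornerD, hornerN, hornerC, hornerXn, hornerMn, expr1n, hornerX).
by move=> dp; rewrite ME; congr EFin; lra.
Qed.

Variables (k : nat) (m : 'cV[R]_k) (C : 'M[R]_k).
Hypothesis CP : sym_posdef C.

Lemma gaussian_second_moment :
  (\int[mu_ k]_z ((bilform (invmx C) (z - m) (z - m))%:E *
    (gaussian_pdf m C z)%:E) = k%:R%:E)%E.
Proof.
have CVP := sym_posdef_invmx CP; have peak0 := gaussian_peak_gt0 CP.
transitivity (\int[mu_ k]_z ((Num.sqrt ((2 * pi) ^+ k * \det C))^-1 *
  (bilform (invmx C) (z - m) (z - m) *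
   expR (- bilform (invmx C) (z - m) (z - m) / 2)))%:E)%E.
  by apply: eq_integral => z _; rewrite gaussian_pdfE -EFinM mulrCA.
pose f (z : 'cV[R]_k) := bilform (invmx C) z z * expR (- bilform (invmx C) z z / 2).
have f0 z : 0 <= f z by rewrite mulr_ge0 ?expR_ge0//; exact: sym_posdef_ge0.
have mf : measurable_fun setT f.
  by apply: measurable_funM; [exact: measurable_quad|exact: measurable_expR_quad].
rewrite (ge0_integralMl (mu_ k) (f := fun z => f (z - m))); last 3 first.
- by rewrite invr_ge0 ltW.
- by apply: measurableT_comp => //; exact: measurable_sub_cV.
- by move=> z; exact: f0.
rewrite (@ge0_integral_shift_cV R k (- m) (fun z => (f z)%:E)); last 2 first.
- exact/measurable_EFinP.
- by move=> z; rewrite lee_fin.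
rewrite integral_quad_expR// -EFinM det_inv invrK mulrCA mulVf ?mulr1//.
by rewrite gt_eqF.
Qed.

End gaussian_second_moment.

Section gaussian_entropy.
Context {R : realType} {d : measure_display} {T : measurableType d}.
Variable P : probability T R.
Local Notation mu_ := (@lebesgue_cV R).

(** The density selected by [pdf] differs from g only on a Lebesgue null set, and Z falls into that
    set with probability 0. *)
Lemma entropyE k (Z : T -> 'cV[R]_k) g : measurable_fun setT Z ->
  has_pdf P Z g -> entropy P Z = (\int[P]_t (- ln (g (Z t)))%:E)%E.
Proof.
move=> mZ gZ; have fZ : has_pdf P Z (pdf P Z) by apply: xgetPex; exists g.
rewrite /entropy unlock; move: (pdf P Z) fZ => f fZ.
have [mf f0 Pf] := fZ; have [mg g0 Pg] := gZ.
pose N := setT `&` [set z | (f z)%:E != (g z)%:E].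
have mN : measurable N by apply: measurable_neqe => //; exact/measurable_EFinP.
have N0 : mu_ k N = 0%E.
  apply: measure_negligible => //.
  apply: negligibleS (has_pdf_unique fZ gZ) => z [_ /eqP fg].
  by move=> /(_ I).
apply: ae_eq_integral => //.
- by apply/measurable_EFinP/measurableT_comp => //; do 2 apply: measurableT_comp => //.
- by apply/measurable_EFinP/measurableT_comp => //; do 2 apply: measurableT_comp => //.
exists (Z @^-1` N); split.
- by rewrite -[_ @^-1` _]setTI; exact: mZ.
- apply: (eq_trans (Pf _ mN)); apply: null_set_integral => //.
  by apply: measurable_funTS; exact/measurable_EFinP.
- by move=> t /= fg; split => //=; apply/eqP => -[fgE]; apply: fg => _; rewrite fgE.
Qed.

(** Minus the logarithm of the density is a constant plus half of the quadratic form of [invmx C] at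
    [Z t - m], whose mean is the dimension k. *)
Lemma entropy_gaussian k (Z : T -> 'cV[R]_k) m (C : 'M[R]_k) :
  measurable_fun setT Z -> sym_posdef C -> gaussian P Z m C ->
  entropy P Z = ((k%:R * (1 + ln (2 * pi)) + ln (\det C)) / 2)%:E.
Proof.
move=> mZ CP ZG; rewrite (entropyE mZ ZG).
have d0 := sym_posdef_det_gt0 CP; have peak0 := gaussian_peak_gt0 CP.
have tpi0 : 0 < 2 * pi :> R by rewrite mulr_gt0 ?pi_gt0.
pose q t := bilform (invmx C) (Z t - m) (Z t - m).
have q0 t : 0 <= q t by exact/sym_posdef_ge0/sym_posdef_invmx.
have mq : measurable_fun setT q by apply: measurable_quad; exact: measurable_sub_cV.
have qE : (\int[P]_t (q t)%:E = k%:R%:E)%E.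
  rewrite -(gaussian_second_moment m CP).
  rewrite (has_pdf_integral
    (h := fun z => (bilform (invmx C) (z - m) (z - m))%:E) mZ ZG)//.
    by apply/measurable_EFinP; apply: measurable_quad; exact: measurable_sub_cV.
  by move=> z; rewrite lee_fin; exact/sym_posdef_ge0/sym_posdef_invmx.
have iq : P.-integrable setT (EFin \o q) by exact: ge0_integrable_fin qE.
pose a := ln ((2 * pi) ^+ k * \det C) / 2.
have lnE t : (- ln (gaussian_pdf m C (Z t)))%:E = (a%:E + 2^-1%:E * (q t)%:E)%E.
  rewrite gaussian_pdfE -/(q t) lnM ?posrE ?invr_gt0 ?expR_gt0// expRK.
  rewrite lnV ?posrE// -EFinM -EFinD; congr EFin.
  rewrite /a; set x := _ * \det C.
  have x0 : 0 < x by rewrite mulr_gt0// exprn_gt0.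
  have := congr1 (@ln R) (sqr_sqrtr (ltW x0)); rewrite lnXn ?sqrtr_gt0// => <-.
  by rewrite -mulr_natr; field.
under eq_integral do rewrite lnE.
rewrite integralD//; last 2 first.
- exact: finite_measure_integrable_cst.
- exact: integrableZl.
have -> : (\int[P]__ a%:E)%E = a%:E.
  by rewrite integral_cst//= [P _]probability_setT mule1.
rewrite integralZl// qE -EFinM -EFinD.
congr EFin; rewrite /a lnM ?posrE ?exprn_gt0// lnXn//.
by rewrite -mulr_natr; field.
Qed.

End gaussian_entropy.

(** * Mutual information in the linear Gaussian model *)

Section linear_gaussian_model.
Context {R : realType} {d : measure_display} {T : measurableType d}.
Variable P : probability T R.

Lemma mutual_info_linear r q (A : 'M[R]_(r, q)) (N : T -> 'cV[R]_r)
    (X : T -> 'cV[R]_q) mN mX S C :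
  measurable_fun setT N -> measurable_fun setT X ->
  sym_posdef S -> sym_posdef C ->
  gaussian P N mN S -> gaussian P X mX C -> independent_vectors P N X ->
  mutual_info P (fun t => A *m X t + N t) X =
  ((ln (\det (A *m C *m A^T + S)) - ln (\det S)) / 2)%:E.
Proof.
move=> mN' mX' SP CP NG XG ind.
have NXG := gaussian_col_mx mN' mX' SP CP NG XG ind.
have NXP := block_diag_sym_posdef SP CP.
have mNX := measurable_col_mx mN' mX'.
pose D := block_mx S 0 0 C; pose L := row_mx (1%:M : 'M[R]_r) A.
pose J := block_mx (1%:M : 'M[R]_r) A 0 (1%:M : 'M[R]_q).
have Lfree : row_free L.
  by apply/row_freeP; exists (col_mx 1%:M 0); rewrite mul_row_col mulmx0 addr0 mulmx1.
have Jdet : \det J = 1 by rewrite det_ublock !det1 mulr1.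
have Jfree : row_free J by rewrite row_free_unit unitmxE Jdet unitr1.
have LE t : L *m col_mx (N t) (X t) = A *m X t + N t.
  by rewrite mul_row_col mul1mx addrC.
have JE t : J *m col_mx (N t) (X t) = col_mx (A *m X t + N t) (X t).
  by rewrite mul_block_col !mul1mx mul0mx add0r addrC.
have LD : L *m D *m L^T = A *m C *m A^T + S.
  rewrite mul_row_block !mulmx0 addr0 add0r mul1mx tr_row_mx mul_row_col trmx1.
  by rewrite mulmx1 addrC.
have LG := gaussian_mulmx mNX NXP Lfree NXG.
have JG := gaussian_mulmx mNX NXP Jfree NXG.
rewrite /mutual_info.
have -> : entropy P (fun t => A *m X t + N t) =
    entropy P (fun t => L *m col_mx (N t) (X t)).
  by congr entropy; apply/funext => t; rewrite LE.
have -> : entropy P (fun t => col_mx (A *m X t + N t) (X t)) =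
    entropy P (fun t => J *m col_mx (N t) (X t)).
  by congr entropy; apply/funext => t; rewrite JE.
rewrite (entropy_gaussian (measurable_mulmx_cV L mNX) _ LG); last first.
  exact: sym_posdef_congr.
rewrite (entropy_gaussian (measurable_mulmx_cV J mNX) _ JG); last first.
  exact: sym_posdef_congr.
rewrite (entropy_gaussian mX' CP XG) -/D LD.
have -> : \det (J *m D *m J^T) = \det S * \det C.
  by rewrite !det_mulmx det_tr Jdet mul1r mulr1 det_ublock.
have EFin3 (a b c e : R) : a + b - c = e -> (a%:E + b%:E - c%:E = e%:E)%E.
  by move=> <-.
have lnSC : ln (\det S * \det C) = ln (\det S) + ln (\det C).
  by rewrite lnM// posrE sym_posdef_det_gt0.
(* The terms proportional to the dimension cancel because r and q add up to the dimension of the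
   joint vector, and the entropy of X removes [ln (\det C)]. *)
by apply: EFin3; rewrite lnSC natrD; field.
Qed.

Lemma independent_vectors_comp p k p' (X : T -> 'cV[R]_p) (E : T -> 'cV[R]_k)
    (f : 'cV[R]_k -> 'cV[R]_p') :
  measurable_fun setT f -> independent_vectors P X E ->
  independent_vectors P (f \o E) X.
Proof.
move=> mf ind A B mA mB; rewrite comp_preimage setIC ind//; first exact: muleC.
by rewrite -[_ @^-1` _]setTI; exact: mf.
Qed.

End linear_gaussian_model.

Lemma ln_prod (R : realType) (I : finType) (D : pred I) (l : I -> R) :
  (forall i, 0 < l i) -> ln (\prod_(i | D i) l i) = \sum_(i | D i) ln (l i).
Proof.
(* The relation carries the positivity of the partial products along, as the logarithm of a product
   requires it. *)
move=> l0; pose K (a b : R) := 0 < a /\ ln a = b.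
suff [] : K (\prod_(i | D i) l i) (\sum_(i | D i) ln (l i)) by [].
apply: (big_ind2 K) => [|a b a' b' [a0 <-] [a'0 <-]|i _]; rewrite /K.
- by rewrite ltr01 ln1.
- by rewrite mulr_gt0// lnM.
- by [].
Qed.

Theorem corollary3p8 (R : realType) (d : measure_display)
    (T : measurableType d) (P : probability T R) (n q r m : nat)
    (B : 'M[R]_(n, q))
    (mX : 'cV[R]_q) (CX : 'M[R]_q) (mE : 'cV[R]_n) (CE : 'M[R]_n)
    (X : {RV P >-> 'cV[R]_q}) (E : {RV P >-> 'cV[R]_n})
    (V : 'M[R]_(n, r)) (lambda nu : 'I_n -> R) :
  let Y := fun t => B *m X t + E t in
  let W := fun t => V^T *m Y t in
  let CA := B *m CX *m B^T in
  let CY := CA + CE in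
  let IYX := mutual_info P Y X in
  let IWX := mutual_info P W X in
  sym_posdef CX -> sym_posdef CE ->
  gaussian P X mX CX -> gaussian P E mE CE ->
  independent_vectors P X E ->
  (1 <= r <= n)%N ->
  full_rank V ->
  (forall V' : 'M[R]_(n, r), full_rank V' ->
     (mutual_info P (fun t => V'^T *m Y t) X <= IWX)%E) ->
  gen_eigenvalues CY CE lambda ->
  gen_eigenvalues CA CE nu ->
  \rank B = m -> (m <= q < n)%N ->
  [/\ (forall i, 0 <= nu i /\ lambda i = 1 + nu i),
      \rank CA = m,
      IYX \is a fin_num /\ IWX \is a fin_num,
      (IYX != 0%E ->
         (fine IYX - fine IWX) / fine IYX =
         1 - (\sum_(i < n | (i < r)%N) ln (1 + nu i)) /
             (\sum_(i < n | (i < m)%N) ln (1 + nu i))) &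
      ((m <= r)%N -> IWX = IYX) /\ (r = q -> (m <= r)%N)].
Proof.
move=> Y W CA CY IYX IWX CXP CEP XG EG XE /andP[r0 rn] Vfull Vmax lamE nuE Bm.
move=> /andP[mq qn].
have mX' : measurable_fun setT X by []. have mE' : measurable_fun setT E by [].
have [CXsym _] := CXP.
have CAsym : CA^T = CA by rewrite /CA !trmx_mul trmxK CXsym mulmxA.
have CApos (v : 'cV[R]_n) : 0 <= (v^T *m CA *m v) 0 0.
  have := sym_posdef_ge0 (B^T *m v) CXP.
  by rewrite trmx_mul trmxK !mulmxA.
have CYP : sym_posdef CY by exact: sym_posdefD.
have CArank : \rank CA = m by rewrite -Bm; exact: mxrank_congr_posdef.
have nu0 i : 0 <= nu i by exact: gen_eigenvalues_ge0 nuE.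
have lamnu : lambda =1 (fun i => 1 + nu i).
  by apply: gen_eigenvalues_unique lamE _; exact: gen_eigenvaluesD1.
have lam0 i : 0 < lambda i by rewrite lamnu ltr_wpDr.
have num (i : 'I_n) : (m <= i)%N -> nu i = 0.
  by rewrite -CArank; exact: gen_eigenvalues_eq0 nuE.
(* Multiplying the model by [U^T] gives a linear model again, with matrix [U^T *m B] and noise
   [U^T *m E t]. *)
have info k (U : 'M[R]_(n, k)) : row_free U^T ->
    mutual_info P (fun t => U^T *m Y t) X =
    ((ln (\det (U^T *m CY *m U^T^T)) - ln (\det (U^T *m CE *m U^T^T))) / 2)%:E.
  move=> Ufree.
  have UEG := gaussian_mulmx mE' CEP Ufree EG.
  have mUE := measurable_mulmx_cV U^T mE'.
  have UEX : independent_vectors P (fun t => U^T *m E t) X.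
    by apply: independent_vectors_comp XE; exact: measurable_mulmx_cV.
  have UEP := sym_posdef_congr CEP Ufree.
  have := mutual_info_linear (U^T *m B) mUE mX' UEP CXP UEG XG UEX.
  have -> : (fun t => U^T *m B *m X t + U^T *m E t) = (fun t => U^T *m Y t).
    by apply/funext => t; rewrite /Y mulmxDr mulmxA.
  move=> ->; congr (((ln (\det _) - _) / 2)%:E).
  by rewrite /CY /CA mulmxDr mulmxDl trmx_mul !mulmxA.
pose s k := \sum_(i < n | (i < k)%N) ln (1 + nu i).
have sprod k : ln (\prod_(i < n | (i < k)%N) lambda i) = s k.
  by rewrite ln_prod//; apply: eq_bigr => i _; rewrite lamnu.
have sE k : (m <= k)%N -> s k = s m.
  move=> mk; rewrite /s big_mkcond [RHS]big_mkcond; apply: eq_bigr => i _ /=.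
  have [im|mi] := ltnP i m; first by rewrite (leq_trans im mk).
  by rewrite num// addr0 ln1 if_same.
have IYXE : IYX = (s m / 2)%:E.
  (* The full observation is the case of the identity matrix, where the determinant ratio is the
     product of all n eigenvalues; by [sE] the sum may stop at m. *)
  have -> : IYX = mutual_info P (fun t => 1%:M^T *m Y t) X.
    by congr mutual_info; apply/funext => t; rewrite trmx1 mul1mx.
  rewrite info; last by rewrite trmx1 row_free_unit unitmx1.
  rewrite !trmx1 !mul1mx !mulmx1.
  rewrite (gen_eigen_det CYP CEP lamE) lnM ?posrE ?sym_posdef_det_gt0//; last first.
    by apply: prodr_gt0.
  rewrite addrK -(sE n (ltnW (leq_ltn_trans mq qn))) -sprod.
  by congr ((ln _ / 2)%:E); apply: eq_bigl => i; rewrite ltn_ord.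
have Vfree : row_free V^T by rewrite /row_free mxrank_tr Vfull (minn_idPr rn).
have lprod k : 0 < \prod_(i < n | (i < k)%N) lambda i by exact: prodr_gt0.
have IWXE : IWX = (s r / 2)%:E.
  (* The upper bound applies to V itself; the lower bound compares V with the top eigenvector matrix
     [V1] through the maximality of V. *)
  apply/eqP; rewrite eq_le; apply/andP; split.
    rewrite /IWX /W info// lee_fin ler_pM2r// -sprod lerBlDr.
    rewrite -lnM ?posrE//; last first.
      exact/sym_posdef_det_gt0/sym_posdef_congr.
    rewrite ler_ln ?posrE ?mulr_gt0 ?sym_posdef_det_gt0//.
    - by apply: (gen_eigen_det_le CYP CEP lamE) => // i; exact: ltW.
    - exact: sym_posdef_congr.
    - exact: sym_posdef_congr.
  have [V1 [V1free V1det]] := gen_eigen_topP CYP CEP lamE rn.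
  have V1T : row_free V1^T^T by rewrite trmxK.
  have := Vmax V1^T; rewrite /full_rank mxrank_tr (eqP V1free) (minn_idPr rn).
  move=> /(_ erefl); apply: le_trans.
  rewrite info// trmxK V1det lnM ?posrE//; last first.
    exact/sym_posdef_det_gt0/sym_posdef_congr.
  by rewrite addrK sprod.
split => //.
- by rewrite IYXE IWXE.
- rewrite IYXE IWXE /= => IYX0.
  (* This makes both denominators nonzero, after which the common factor 1/2 cancels. *)
  have s0 : s m != 0 by apply: contra_neq IYX0 => ->; rewrite mul0r.
  by rewrite -/(s r) -/(s m); field.
- split; last by move=> ->.
  by move=> mr; rewrite IYXE IWXE sE.
Qed.
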